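(* The class of forests is tractable. In other words, the following are true: (QA) a forest is asymmetric if and only if it has a trivial quantum automorphism group; (QI) two quantum isomorphic forests are isomorphic; (SA) a forest has quantum symmetry if and only if it satisfies Schmidt's criterion.
   Context: Graphs are finite, simple and undirected, with at least one vertex. A forest is a graph all of whose connected components are trees. A graph is asymmetric if its automorphism group is trivial. A magic unitary with coefficients in a nonzero unital $C^*$-algebra $X$ is a square matrix whose entries are self-adjoint projections of $X$ with every row and column summing to $1_X$. $G$ and $H$ (with equally many vertices) are quantum isomorphic if there is a magic unitary $U$, with coefficients in some nonzero unital $C^*$-algebra, rows indexed by $V(H)$ and columns by $V(G)$, with $U\,\mathrm{Adj}(G)=\mathrm{Adj}(H)\,U$ ($\mathrm{Adj}$ = adjacency matrix). $\mathcal O(\mathrm{Qu}(G))$ is the universal unital complex $*$-algebra generated by $u_{xy}$ ($x,y\in V(G)$) with relations $u_{xy}^*=u_{xy}=u_{xy}^2$, $\sum_y u_{xy}=1=\sum_y u_{yx}$, $u_{xy}u_{xz}=0=u_{yx}u_{zx}$ for $y\ne z$, and $u\,\mathrm{Adj}(G)=\mathrm{Adj}(G)\,u$; $C(\mathrm{Qu}(G))$ is its universal enveloping $C^*$-algebra. The quantum automorphism group $\mathrm{Qu}(G)$ is trivial if $\mathcal O(\mathrm{Qu}(G))=\mathbb C$. $G$ has quantum symmetry if $C(\mathrm{Qu}(G))$ is not commutative. $G$ satisfies Schmidt's criterion if it has two nontrivial automorphisms with disjoint supports, where $\mathrm{Supp}(f)=\{x\in V(G)\mid f(x)\neq x\}$.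 *)

(* Defs.v *)
From HB Require Import structures.
From mathcomp Require Import fingroup perm.
From mathcomp Require Import all_boot all_order all_algebra.
From mathcomp Require Import complex.
From mathcomp Require Import boolp classical_sets reals topology normedtype.
From mathcomp Require Import sequences.
From mathcomp Require Import lra.

Set Implicit Arguments.
Unset Strict Implicit.
Unset Printing Implicit Defensive.

Import Order.TTheory GRing.Theory Num.Theory.
Import numFieldNormedType.Exports.
Import ComplexField.Normc.

Local Open Scope classical_set_scope.
Local Open Scope ring_scope.
Local Open Scope complex_scope.
Local Open Scope quotient_scope.

Local Arguments normc : simpl never.

(* [algType] algebras are unital and satisfy [1 != 0], so all *-algebras and
   all C*-algebras below are unital and nonzero. *)
HB.mixin Record Algebra_isStarAlgebra (R : realType) A
    & GRing.Algebra R[i] A := {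
  star : A -> A;
  starK : forall x, star (star x) = x;
  starD : forall x y, star (x + y) = star x + star y;
  starZ : forall (c : R[i]) x, star (c *: x) = c^*%C *: star x;
  starM : forall x y, star (x * y) = star y * star x
}.

#[short(type="starAlgType")]
HB.structure Definition StarAlgebra (R : realType) :=
  {A of GRing.Algebra R[i] A & Algebra_isStarAlgebra R A}.

(* The norm is a field of the mixin, and completeness is spelled out with Cauchy
   sequences, because [Num.NumDomain] prevents Hierarchy-Builder from joining
   rings and normed modules into a structure of normed algebras. *)
HB.mixin Record isCStarAlgebra (R : realType) A & StarAlgebra R A := {
  cnorm : A -> R;
  cnorm_ge0 : forall x, 0 <= cnorm x;
  cnorm_eq0 : forall x, cnorm x = 0 -> x = 0;
  cnormD : forall x y, cnorm (x + y) <= cnorm x + cnorm y;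
  cnormZ : forall (c : R[i]) x, cnorm (c *: x) = normc c * cnorm x;
  cnormM : forall x y, cnorm (x * y) <= cnorm x * cnorm y;
  cnorm_starM : forall x, cnorm (star x * x) = cnorm x ^+ 2;
  cnorm_complete : forall u : nat -> A,
    (forall e : R, 0 < e -> exists N, forall m n, (N <= m)%N -> (N <= n)%N ->
      cnorm (u m - u n) < e) ->
    exists l, (fun n => cnorm (u n - l)) @ \oo --> (0 : R)
}.

#[short(type="cstarAlgType")]
HB.structure Definition CStarAlgebra (R : realType) :=
  {A of StarAlgebra R A & isCStarAlgebra R A}.

(* A set with operations satisfying the axioms of *-algebras up to a congruence
   [ps_eq]; its quotient is a *-algebra. *)
Record preStarAlg (R : realType) := PreStarAlg {
  ps_sort :> choiceType;
  ps_eq : ps_sort -> ps_sort -> Prop;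
  ps_zero : ps_sort;
  ps_one : ps_sort;
  ps_opp : ps_sort -> ps_sort;
  ps_add : ps_sort -> ps_sort -> ps_sort;
  ps_mul : ps_sort -> ps_sort -> ps_sort;
  ps_scale : R[i] -> ps_sort -> ps_sort;
  ps_star : ps_sort -> ps_sort;
  ps_refl : forall x, ps_eq x x;
  ps_sym : forall x y, ps_eq x y -> ps_eq y x;
  ps_trans : forall x y z, ps_eq x y -> ps_eq y z -> ps_eq x z;
  ps_congr_opp : forall x x', ps_eq x x' -> ps_eq (ps_opp x) (ps_opp x');
  ps_congr_add : forall x x' y y', ps_eq x x' -> ps_eq y y' ->
    ps_eq (ps_add x y) (ps_add x' y');
  ps_congr_mul : forall x x' y y', ps_eq x x' -> ps_eq y y' ->
    ps_eq (ps_mul x y) (ps_mul x' y');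
  ps_congr_scale : forall c x x', ps_eq x x' ->
    ps_eq (ps_scale c x) (ps_scale c x');
  ps_congr_star : forall x x', ps_eq x x' -> ps_eq (ps_star x) (ps_star x');
  ps_addA : forall x y z,
    ps_eq (ps_add x (ps_add y z)) (ps_add (ps_add x y) z);
  ps_addC : forall x y, ps_eq (ps_add x y) (ps_add y x);
  ps_add0 : forall x, ps_eq (ps_add ps_zero x) x;
  ps_addN : forall x, ps_eq (ps_add (ps_opp x) x) ps_zero;
  ps_mulA : forall x y z,
    ps_eq (ps_mul x (ps_mul y z)) (ps_mul (ps_mul x y) z);
  ps_mul1l : forall x, ps_eq (ps_mul ps_one x) x;
  ps_mul1r : forall x, ps_eq (ps_mul x ps_one) x;
  ps_mulDl : forall x y z,
    ps_eq (ps_mul (ps_add x y) z) (ps_add (ps_mul x z) (ps_mul y z));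
  ps_mulDr : forall x y z,
    ps_eq (ps_mul x (ps_add y z)) (ps_add (ps_mul x y) (ps_mul x z));
  ps_scaleA : forall a b x,
    ps_eq (ps_scale a (ps_scale b x)) (ps_scale (a * b) x);
  ps_scale1 : forall x, ps_eq (ps_scale 1 x) x;
  ps_scaleDr : forall a x y,
    ps_eq (ps_scale a (ps_add x y)) (ps_add (ps_scale a x) (ps_scale a y));
  ps_scaleDl : forall a b x,
    ps_eq (ps_scale (a + b) x) (ps_add (ps_scale a x) (ps_scale b x));
  ps_scaleAl : forall a x y,
    ps_eq (ps_scale a (ps_mul x y)) (ps_mul (ps_scale a x) y);
  ps_scaleAr : forall a x y,
    ps_eq (ps_scale a (ps_mul x y)) (ps_mul x (ps_scale a y));
  ps_starK : forall x, ps_eq (ps_star (ps_star x)) x;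
  ps_starD : forall x y,
    ps_eq (ps_star (ps_add x y)) (ps_add (ps_star x) (ps_star y));
  ps_starZ : forall a x,
    ps_eq (ps_star (ps_scale a x)) (ps_scale a^*%C (ps_star x));
  ps_starM : forall x y,
    ps_eq (ps_star (ps_mul x y)) (ps_mul (ps_star y) (ps_star x));
  ps_neq : ~ ps_eq ps_one ps_zero
}.

Section Quotient.
Context (R : realType) (P : preStarAlg R).

Definition ps_rel : rel P := fun x y => `[< ps_eq x y >].

Lemma ps_rel_equiv : equiv_class_of ps_rel.
Proof.
split.
- by move=> x; apply/asboolP/ps_refl.
- by move=> x y; apply/asboolP/asboolP; apply: ps_sym.
- by move=> y x z /asboolP xy /asboolP yz; apply/asboolP/(ps_trans xy yz).
Qed.

Canonical ps_equiv := EquivRelPack ps_rel_equiv.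

Definition quot := {eq_quot ps_equiv}.

HB.instance Definition _ := Choice.on quot.
HB.instance Definition _ := EqQuotient.on quot.

Definition qpi (x : P) : quot := \pi_quot x.

Lemma qpiP x y : qpi x = qpi y <-> ps_eq x y.
Proof. by split=> [/eqmodP/asboolP|] // xy; apply/eqmodP/asboolP. Qed.

Lemma qpi_eq x y : ps_eq x y -> qpi x = qpi y.
Proof. by move/qpiP. Qed.

Lemma qpiW (Q : quot -> Prop) : (forall x, Q (qpi x)) -> forall x, Q x.
Proof. exact: quotW. Qed.

Lemma qrepr x : ps_eq (repr (qpi x)) x.
Proof. by apply/qpiP; rewrite /qpi reprK. Qed.

Definition qzero : quot := qpi (ps_zero P).
Definition qone : quot := qpi (ps_one P).
Definition qopp (x : quot) : quot := qpi (ps_opp (repr x)).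
Definition qadd (x y : quot) : quot := qpi (ps_add (repr x) (repr y)).
Definition qmul (x y : quot) : quot := qpi (ps_mul (repr x) (repr y)).
Definition qscale c (x : quot) : quot := qpi (ps_scale c (repr x)).
Definition qstar (x : quot) : quot := qpi (ps_star (repr x)).

Lemma qoppE x : qopp (qpi x) = qpi (ps_opp x).
Proof. by apply/qpi_eq/ps_congr_opp/qrepr. Qed.
Lemma qaddE x y : qadd (qpi x) (qpi y) = qpi (ps_add x y).
Proof. by apply/qpi_eq/ps_congr_add; apply/qrepr. Qed.
Lemma qmulE x y : qmul (qpi x) (qpi y) = qpi (ps_mul x y).
Proof. by apply/qpi_eq/ps_congr_mul; apply/qrepr. Qed.
Lemma qscaleE c x : qscale c (qpi x) = qpi (ps_scale c x).
Proof. by apply/qpi_eq/ps_congr_scale/qrepr. Qed.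
Lemma qstarE x : qstar (qpi x) = qpi (ps_star x).
Proof. by apply/qpi_eq/ps_congr_star/qrepr. Qed.

Let qE := (qoppE, qaddE, qmulE, qscaleE, qstarE).

Lemma qaddA : associative qadd.
Proof.
elim/qpiW=> x; elim/qpiW=> y; elim/qpiW=> z.
by rewrite !qE; apply/qpi_eq/ps_addA.
Qed.
Lemma qaddC : commutative qadd.
Proof. by elim/qpiW=> x; elim/qpiW=> y; rewrite !qE; apply/qpi_eq/ps_addC. Qed.
Lemma qadd0 : left_id qzero qadd.
Proof. by elim/qpiW=> x; rewrite !qE; apply/qpi_eq/ps_add0. Qed.
Lemma qaddN : left_inverse qzero qopp qadd.
Proof. by elim/qpiW=> x; rewrite !qE; apply/qpi_eq/ps_addN. Qed.

HB.instance Definition _ := GRing.isZmodule.Build quot qaddA qaddC qadd0 qaddN.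

Lemma qmulA : associative qmul.
Proof.
elim/qpiW=> x; elim/qpiW=> y; elim/qpiW=> z.
by rewrite !qE; apply/qpi_eq/ps_mulA.
Qed.
Lemma qmul1l : left_id qone qmul.
Proof. by elim/qpiW=> x; rewrite !qE; apply/qpi_eq/ps_mul1l. Qed.
Lemma qmul1r : right_id qone qmul.
Proof. by elim/qpiW=> x; rewrite !qE; apply/qpi_eq/ps_mul1r. Qed.
Lemma qmulDl : left_distributive qmul qadd.
Proof.
elim/qpiW=> x; elim/qpiW=> y; elim/qpiW=> z.
by rewrite !qE; apply/qpi_eq/ps_mulDl.
Qed.
Lemma qmulDr : right_distributive qmul qadd.
Proof.
elim/qpiW=> x; elim/qpiW=> y; elim/qpiW=> z.
by rewrite !qE; apply/qpi_eq/ps_mulDr.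
Qed.
Lemma qone_neq0 : qone != qzero.
Proof. by apply/eqP => /qpiP; apply: ps_neq. Qed.

HB.instance Definition _ := GRing.Zmodule_isNzRing.Build quot
  qmulA qmul1l qmul1r qmulDl qmulDr qone_neq0.

Lemma qscaleA a b x : qscale a (qscale b x) = qscale (a * b) x.
Proof. by elim/qpiW: x => x; rewrite !qE; apply/qpi_eq/ps_scaleA. Qed.
Lemma qscale1 : left_id 1 qscale.
Proof. by elim/qpiW=> x; rewrite !qE; apply/qpi_eq/ps_scale1. Qed.
Lemma qscaleDr : right_distributive qscale +%R.
Proof.
move=> a; elim/qpiW=> x; elim/qpiW=> y.
by rewrite /GRing.add/= !qE; apply/qpi_eq/ps_scaleDr.
Qed.
Lemma qscaleDl x : {morph qscale^~ x : a b / a + b}.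
Proof.
move=> a b; elim/qpiW: x => x.
by rewrite /= [RHS]/GRing.add/= !qE; apply/qpi_eq/ps_scaleDl.
Qed.

HB.instance Definition _ := GRing.Zmodule_isLmodule.Build R[i] quot
  qscaleA qscale1 qscaleDr qscaleDl.

Lemma qscaleAl (a : R[i]) (x y : quot) : a *: (x * y) = (a *: x) * y.
Proof.
elim/qpiW: x => x; elim/qpiW: y => y.
by rewrite /GRing.scale/GRing.mul/= !qE; apply/qpi_eq/ps_scaleAl.
Qed.
Lemma qscaleAr (a : R[i]) (x y : quot) : a *: (x * y) = x * (a *: y).
Proof.
elim/qpiW: x => x; elim/qpiW: y => y.
by rewrite /GRing.scale/GRing.mul/= !qE; apply/qpi_eq/ps_scaleAr.
Qed.

HB.instance Definition _ := GRing.Lmodule_isLalgebra.Build R[i] quot qscaleAl.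
HB.instance Definition _ := GRing.Lalgebra_isAlgebra.Build R[i] quot qscaleAr.

Lemma qstarK (x : quot) : qstar (qstar x) = x.
Proof. by elim/qpiW: x => x; rewrite !qE; apply/qpi_eq/ps_starK. Qed.
Lemma qstarD (x y : quot) : qstar (x + y) = qstar x + qstar y.
Proof.
elim/qpiW: x => x; elim/qpiW: y => y.
by rewrite /GRing.add/= !qE; apply/qpi_eq/ps_starD.
Qed.
Lemma qstarZ (a : R[i]) (x : quot) : qstar (a *: x) = a^*%C *: qstar x.
Proof.
elim/qpiW: x => x.
by rewrite /GRing.scale/= !qE; apply/qpi_eq/ps_starZ.
Qed.
Lemma qstarM (x y : quot) : qstar (x * y) = qstar y * qstar x.
Proof.
elim/qpiW: x => x; elim/qpiW: y => y.
by rewrite /GRing.mul/= !qE; apply/qpi_eq/ps_starM.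
Qed.

HB.instance Definition _ := Algebra_isStarAlgebra.Build R quot
  qstarK qstarD qstarZ qstarM.

Lemma qpi0 : qpi (ps_zero P) = 0. Proof. by []. Qed.
Lemma qpi1 : qpi (ps_one P) = 1. Proof. by []. Qed.
Lemma qpiN x : qpi (ps_opp x) = - qpi x.
Proof. by rewrite -qoppE. Qed.
Lemma qpiD x y : qpi (ps_add x y) = qpi x + qpi y.
Proof. by rewrite -qaddE. Qed.
Lemma qpiM x y : qpi (ps_mul x y) = qpi x * qpi y.
Proof. by rewrite -qmulE. Qed.
Lemma qpiZ c x : qpi (ps_scale c x) = c *: qpi x.
Proof. by rewrite -qscaleE. Qed.
Lemma qpi_star x : qpi (ps_star x) = star (qpi x).
Proof. by rewrite -qstarE. Qed.

End Quotient.

(* Nonzero C*-seminorms; the normalisation [csn 1 = 1] is equivalent to the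
   seminorm being nonzero. *)
Record cstarSeminorm (R : realType) (O : starAlgType R) := CStarSeminorm {
  csn :> O -> R;
  csn_ge0 : forall x, 0 <= csn x;
  csnD : forall x y, csn (x + y) <= csn x + csn y;
  csnZ : forall (c : R[i]) x, csn (c *: x) = normc c * csn x;
  csnM : forall x y, csn (x * y) <= csn x * csn y;
  csn_starM : forall x, csn (star x * x) = csn x ^+ 2;
  csn1 : csn 1 = 1
}.

Section SeminormTheory.
Context (R : realType) (O : starAlgType R) (p : cstarSeminorm O).

Lemma star0 : star 0 = 0 :> O.
Proof. by apply: (@addrI _ (star 0)); rewrite -starD !addr0. Qed.

Lemma starN (x : O) : star (- x) = - star x.
Proof. by apply: (@addrI _ (star x)); rewrite -starD !subrr star0. Qed.

Lemma starB (x y : O) : star (x - y) = star x - star y.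
Proof. by rewrite starD starN. Qed.

Lemma star1 : star 1 = 1 :> O.
Proof. by rewrite -[LHS]mul1r -[X in X * _]starK -starM mul1r starK. Qed.

Lemma normcN (c : R[i]) : normc (- c) = normc c.
Proof. by case: c => a b; rewrite /normc /= !sqrrN. Qed.

Lemma csn0 : p 0 = 0.
Proof. by rewrite -(scale0r (1 : O)) csnZ normc0 mul0r. Qed.

Lemma csnN x : p (- x) = p x.
Proof. by rewrite -scaleN1r csnZ normcN normc1 mul1r. Qed.

Lemma csnBC x y : p (x - y) = p (y - x).
Proof. by rewrite -csnN opprB. Qed.

Lemma csnB x y : p (x - y) <= p x + p y.
Proof. by rewrite -(csnN y) csnD. Qed.

Lemma csn_dist x y z : p (x - z) <= p (x - y) + p (y - z).
Proof. by rewrite (le_trans _ (csnD _ _ _))// addrA subrK. Qed.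

Lemma csn_sub_le x y : p x - p y <= p (x - y).
Proof. by rewrite lerBlDr (le_trans _ (csnD _ _ _))// subrK. Qed.

Lemma csn_ler_dist x y : `|p x - p y| <= p (x - y).
Proof. by rewrite ler_norml lerNl opprB csn_sub_le csnBC csn_sub_le. Qed.

Lemma csn_star x : p (star x) = p x.
Proof.
have H y : p y <= p (star y).
  have [->|y0] := eqVneq (p y) 0; first exact: csn_ge0.
  have py : 0 < p y by rewrite lt_neqAle eq_sym y0 csn_ge0.
  by rewrite -(ler_pM2r py) -expr2 -csn_starM csnM.
by apply/le_anti; rewrite H -{2}(starK x) H.
Qed.

End SeminormTheory.

(* The separated completion of a *-algebra for a C*-seminorm: Cauchy sequences
   modulo sequences tending to zero. *)
Section Completion.
Context (R : realType) (O : starAlgType R) (p : cstarSeminorm O).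

Definition csn_cauchy (s : nat -> O) := forall e : R, 0 < e ->
  exists N, forall m n, (N <= m)%N -> (N <= n)%N -> p (s m - s n) < e.

Definition cauchySeq := {s : nat -> O | csn_cauchy s}.

HB.instance Definition _ := gen_eqMixin cauchySeq.
HB.instance Definition _ := gen_choiceMixin cauchySeq.

Definition null_seq (s : nat -> O) := (fun n => p (s n)) @ \oo --> (0 : R).

Definition cs_eq (s t : cauchySeq) := null_seq (fun n => sval s n - sval t n).

Lemma null_seqW (s : nat -> O) (f : nat -> R) :
  (forall n, p (s n) <= f n) -> f @ \oo --> (0 : R) -> null_seq s.
Proof.
move=> sf f0; apply: (@squeeze_cvgr _ _ _ _ (fun=> 0) f) => //; last exact: cvg_cst.
by apply: nearW => n; rewrite csn_ge0 sf.
Qed.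

Lemma cs_eq_ext (s t : cauchySeq) : sval s =1 sval t -> cs_eq s t.
Proof.
move=> st; apply: (@null_seqW _ (fun=> 0)); last exact: cvg_cst.
by move=> n; rewrite st subrr csn0.
Qed.

Lemma cs_refl s : cs_eq s s.
Proof. exact: cs_eq_ext. Qed.

Lemma cs_sym s t : cs_eq s t -> cs_eq t s.
Proof. by apply: null_seqW => n; rewrite csnBC. Qed.

Lemma eq_cvgn (f g : nat -> R) (l : R) : f =1 g ->
  f @ \oo --> l -> g @ \oo --> l.
Proof. by move=> /funext ->. Qed.

Lemma cvgDn (f g : nat -> R) (a b : R) : f @ \oo --> a -> g @ \oo --> b ->
  (fun n => f n + g n) @ \oo --> a + b.
Proof. by move=> fa gb; exact: cvgD. Qed.

Lemma cvgMn (f g : nat -> R) (a b : R) : f @ \oo --> a -> g @ \oo --> b ->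
  (fun n => f n * g n) @ \oo --> a * b.
Proof. by move=> fa gb; exact: cvgM. Qed.

Lemma cvgZn (k : R) (f : nat -> R) (a : R) : f @ \oo --> a ->
  (fun n => k * f n) @ \oo --> k * a.
Proof. by move=> fa; apply: cvgMn => //; exact: cvg_cst. Qed.

Lemma cvg0D (f g : nat -> R) : f @ \oo --> (0 : R) -> g @ \oo --> (0 : R) ->
  (fun n => f n + g n) @ \oo --> (0 : R).
Proof. by move=> f0 g0; rewrite -(addr0 0); exact: cvgDn. Qed.

Lemma cvg0Z (k : R) (f : nat -> R) : f @ \oo --> (0 : R) ->
  (fun n => k * f n) @ \oo --> (0 : R).
Proof. by move=> f0; rewrite -(mulr0 k); exact: cvgZn. Qed.

Lemma cs_trans s t u : cs_eq s t -> cs_eq t u -> cs_eq s u.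
Proof.
move=> st tu; apply: null_seqW (cvg0D st tu) => n; exact: csn_dist.
Qed.

Lemma csn_cauchy_bounded s : csn_cauchy s -> exists2 M, 0 < M & forall n, p (s n) <= M.
Proof.
move=> /(_ 1 ltr01)[N sN].
exists (1 + \sum_(i < N.+1) p (s i)).
  by apply: ltr_pwDl => //; apply: sumr_ge0 => i _; exact: csn_ge0.
have le_sum n : (n <= N)%N -> p (s n) <= \sum_(i < N.+1) p (s i).
  move=> nN; rewrite (bigD1 (Ordinal (nN : (n < N.+1)%N)))//= lerDl.
  by apply: sumr_ge0 => i _; exact: csn_ge0.
move=> n; have [nN|Nn] := leqP n N.
  by rewrite (le_trans (le_sum n nN))// lerDr.
rewrite (le_trans (y := 1 + p (s N)))// ?lerD2l ?le_sum//.
rewrite -lerBlDr (le_trans (csn_sub_le _ _ _))//.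
by apply/ltW/sN => //; apply: ltnW.
Qed.

Lemma csn_cauchy_le (s : nat -> O) (f : nat -> nat -> R) :
  (forall m n, p (s m - s n) <= f m n) ->
  (forall e : R, 0 < e ->
    exists N, forall m n, (N <= m)%N -> (N <= n)%N -> f m n < e) ->
  csn_cauchy s.
Proof.
move=> sf fe e /fe[N H]; exists N => m n Nm Nn.
by apply: le_lt_trans (H m n Nm Nn).
Qed.

Lemma csn_cauchy_cst x : csn_cauchy (fun=> x).
Proof. by move=> e e0; exists 0%N => m n _ _; rewrite subrr csn0. Qed.

Lemma csn_cauchyN s : csn_cauchy s -> csn_cauchy (fun n => - s n).
Proof.
move=> sc; apply: csn_cauchy_le sc => m n.
by rewrite -opprD csnN.
Qed.

Lemma csn_cauchyD s t : csn_cauchy s -> csn_cauchy t ->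
  csn_cauchy (fun n => s n + t n).
Proof.
move=> sc tc.
apply: (@csn_cauchy_le _ (fun m n => p (s m - s n) + p (t m - t n))).
  by move=> m n; rewrite opprD addrACA csnD.
move=> e e0; have e2 : 0 < e / 2 by rewrite divr_gt0.
have [N sN] := sc _ e2; have [N' tN] := tc _ e2.
exists (maxn N N') => m n; rewrite !geq_max => /andP[Nm Nm'] /andP[Nn Nn'].
by rewrite [e]splitr ltrD// ?sN ?tN.
Qed.

Lemma csn_cauchyM s t : csn_cauchy s -> csn_cauchy t ->
  csn_cauchy (fun n => s n * t n).
Proof.
move=> sc tc.
have [M M0 sM] := csn_cauchy_bounded sc; have [M' M'0 tM] := csn_cauchy_bounded tc.
apply: (@csn_cauchy_le _ (fun m n => p (s m - s n) * M' + M * p (t m - t n))).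
  move=> m n; have -> : s m * t m - s n * t n =
      (s m - s n) * t m + s n * (t m - t n).
    by rewrite mulrBl mulrBr addrA subrK.
  rewrite (le_trans (csnD _ _ _))// lerD// (le_trans (csnM _ _ _))//.
    by rewrite ler_wpM2l ?csn_ge0.
  by rewrite ler_wpM2r ?csn_ge0.
move=> e e0.
have e1 : 0 < e / 2 / M' by rewrite !divr_gt0.
have e2 : 0 < e / 2 / M by rewrite !divr_gt0.
have [N sN] := sc _ e1; have [N' tN] := tc _ e2.
exists (maxn N N') => m n; rewrite !geq_max => /andP[Nm Nm'] /andP[Nn Nn'].
rewrite [e]splitr ltrD//; first by rewrite -ltr_pdivlMr// sN.
by rewrite mulrC -ltr_pdivlMr// tN.
Qed.

Lemma normc_ge0 (c : R[i]) : 0 <= normc c.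
Proof. by case: c => a b; rewrite /normc sqrtr_ge0. Qed.

Lemma csn_cauchyZ c s : csn_cauchy s -> csn_cauchy (fun n => c *: s n).
Proof.
move=> sc; apply: (@csn_cauchy_le _ (fun m n => (normc c + 1) * p (s m - s n))).
  by move=> m n; rewrite -scalerBr csnZ ler_wpM2r ?csn_ge0// lerDl.
have c0 : 0 < normc c + 1 by rewrite ltr_wpDl ?normc_ge0.
move=> e e0; have [|N sN] := sc (e / (normc c + 1)); first by rewrite divr_gt0.
by exists N => m n Nm Nn; rewrite mulrC -ltr_pdivlMr// sN.
Qed.

Lemma csn_cauchy_star s : csn_cauchy s -> csn_cauchy (fun n => star (s n)).
Proof.
move=> sc; apply: csn_cauchy_le sc => m n.
by rewrite -starB csn_star.
Qed.

Definition cs_cst x : cauchySeq := exist _ _ (csn_cauchy_cst x).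
Definition cs_opp (s : cauchySeq) : cauchySeq := exist _ _ (csn_cauchyN (svalP s)).
Definition cs_add (s t : cauchySeq) : cauchySeq :=
  exist _ _ (csn_cauchyD (svalP s) (svalP t)).
Definition cs_mul (s t : cauchySeq) : cauchySeq :=
  exist _ _ (csn_cauchyM (svalP s) (svalP t)).
Definition cs_scale c (s : cauchySeq) : cauchySeq :=
  exist _ _ (csn_cauchyZ c (svalP s)).
Definition cs_star (s : cauchySeq) : cauchySeq :=
  exist _ _ (csn_cauchy_star (svalP s)).

Lemma cs_congr_opp s s' : cs_eq s s' -> cs_eq (cs_opp s) (cs_opp s').
Proof. by apply: null_seqW => n /=; rewrite -opprD csnN. Qed.

Lemma cs_congr_add s s' t t' : cs_eq s s' -> cs_eq t t' ->
  cs_eq (cs_add s t) (cs_add s' t').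
Proof.
move=> ss tt; apply: null_seqW (cvg0D ss tt) => n /=.
by rewrite opprD addrACA csnD.
Qed.

Lemma cs_congr_mul s s' t t' : cs_eq s s' -> cs_eq t t' ->
  cs_eq (cs_mul s t) (cs_mul s' t').
Proof.
move=> ss tt.
have [M M0 sM] := csn_cauchy_bounded (svalP s').
have [M' M'0 tM] := csn_cauchy_bounded (svalP t).
apply: null_seqW (cvg0D (cvg0Z M' ss) (cvg0Z M tt)) => n /=.
have -> : sval s n * sval t n - sval s' n * sval t' n =
    (sval s n - sval s' n) * sval t n + sval s' n * (sval t n - sval t' n).
  by rewrite mulrBl mulrBr addrA subrK.
rewrite (le_trans (csnD _ _ _))// lerD// (le_trans (csnM _ _ _))//.
  by rewrite mulrC ler_wpM2r ?csn_ge0.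
by rewrite ler_wpM2r ?csn_ge0.
Qed.

Lemma cs_congr_scale c s s' : cs_eq s s' -> cs_eq (cs_scale c s) (cs_scale c s').
Proof.
move=> ss; apply: null_seqW (cvg0Z (normc c) ss) => n /=.
by rewrite -scalerBr csnZ.
Qed.

Lemma cs_congr_star s s' : cs_eq s s' -> cs_eq (cs_star s) (cs_star s').
Proof. by apply: null_seqW => n /=; rewrite -starB csn_star. Qed.

Lemma cs_neq : ~ cs_eq (cs_cst 1) (cs_cst 0).
Proof.
rewrite /cs_eq /null_seq /= subr0 csn1 => /(cvg_lim (@Rhausdorff R)).
by rewrite lim_cst// => /eqP; rewrite oner_eq0.
Qed.

Definition preCompletion : preStarAlg R.
Proof.
refine (@PreStarAlg R cauchySeq cs_eq (cs_cst 0) (cs_cst 1) cs_opp cs_add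
  cs_mul cs_scale cs_star cs_refl cs_sym cs_trans cs_congr_opp cs_congr_add
  cs_congr_mul cs_congr_scale cs_congr_star
  _ _ _ _ _ _ _ _ _ _ _ _ _ _ _ _ _ _ _ cs_neq);
  intros; apply: cs_eq_ext => n /=.
- exact: addrA.
- exact: addrC.
- exact: add0r.
- exact: addNr.
- exact: mulrA.
- exact: mul1r.
- exact: mulr1.
- exact: mulrDl.
- exact: mulrDr.
- exact: scalerA.
- exact: scale1r.
- exact: scalerDr.
- exact: scalerDl.
- exact: scalerAl.
- exact: scalerAr.
- exact: starK.
- exact: starD.
- exact: starZ.
- exact: starM.
Defined.

Definition completion := quot preCompletion.

HB.instance Definition _ := StarAlgebra.on completion.

Definition to_completion (x : O) : completion :=
  qpi (cs_cst x : preCompletion).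

Definition csn_lim (s : cauchySeq) : R := lim ((fun n => p (sval s n)) @ \oo).

Lemma is_cvg_csn (s : cauchySeq) : cvg ((fun n => p (sval s n)) @ \oo).
Proof.
apply: cauchy_cvg; apply/cauchy_exP => e /(svalP s)[N sN].
exists (p (sval s N)); exists N => // n Nn /=.
rewrite /ball/=; apply: le_lt_trans (csn_ler_dist _ _ _) _.
exact: sN.
Qed.

Lemma cvg_csn (s : cauchySeq) : (fun n => p (sval s n)) @ \oo --> csn_lim s.
Proof. exact: is_cvg_csn. Qed.

Lemma csn_limE (s : cauchySeq) r :
  (fun n => p (sval s n)) @ \oo --> r -> csn_lim s = r.
Proof. by move/(cvg_lim (@Rhausdorff R)). Qed.

Lemma csn_lim_eq s t : cs_eq s t -> csn_lim s = csn_lim t.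
Proof.
move=> st; apply: csn_limE.
have H : (fun n => p (sval s n) - p (sval t n)) @ \oo --> (0 : R).
  apply/cvgr0Pnorm_lt => e e0; near=> n.
  apply: le_lt_trans (csn_ler_dist _ _ _) _.
  rewrite -[ltLHS]ger0_norm ?csn_ge0//; near: n.
  by move/cvgr0Pnorm_lt : st; apply.
rewrite -[csn_lim t]add0r; have := cvgDn H (cvg_csn (s := t)).
by apply: eq_cvgn => n; rewrite /= subrK.
Unshelve. all: by end_near. Qed.

Definition completion_norm (x : completion) : R := csn_lim (repr x).

Lemma completion_normE (s : preCompletion) :
  completion_norm (qpi s) = csn_lim s.
Proof. exact/csn_lim_eq/(qrepr s). Qed.

Lemma to_completion_norm x : completion_norm (to_completion x) = p x.
Proof.
rewrite completion_normE; apply: csn_limE.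
by rewrite (_ : (fun _ => _) = fun=> p x)//; exact: cvg_cst.
Qed.

Lemma completion_norm_ge0 x : 0 <= completion_norm x.
Proof.
elim/qpiW: x => s; rewrite completion_normE.
apply: limr_ge; first exact: is_cvg_csn.
by apply: nearW => n; exact: csn_ge0.
Qed.

Lemma completion_norm_eq0 x : completion_norm x = 0 -> x = 0.
Proof.
elim/qpiW: x => s; rewrite completion_normE => s0; apply: qpi_eq.
rewrite /= /cs_eq; under [X in null_seq X]eq_fun do rewrite /= subr0.
by rewrite /null_seq -s0; exact: cvg_csn.
Qed.

Lemma csn_lim_le (s : cauchySeq) (f : nat -> R) r :
  (forall n, p (sval s n) <= f n) -> f @ \oo --> r -> csn_lim s <= r.
Proof.
move=> sf fr; rewrite -(cvg_lim (@Rhausdorff R) fr).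
by apply: ler_lim; [exact: is_cvg_csn|apply/cvg_ex; exists r|exact: nearW].
Qed.

Lemma completion_normD x y :
  completion_norm (x + y) <= completion_norm x + completion_norm y.
Proof.
elim/qpiW: x => s; elim/qpiW: y => t; rewrite -qpiD !completion_normE.
by apply: csn_lim_le (cvgDn (cvg_csn (s := s)) (cvg_csn (s := t))) => n; exact: csnD.
Qed.

Lemma completion_normZ c x :
  completion_norm (c *: x) = normc c * completion_norm x.
Proof.
elim/qpiW: x => s; rewrite -qpiZ !completion_normE; apply: csn_limE.
have := cvgZn (k := normc c) (cvg_csn (s := s)).
by apply: eq_cvgn => n; rewrite /= csnZ.
Qed.

Lemma completion_normM x y :
  completion_norm (x * y) <= completion_norm x * completion_norm y.
Proof.
elim/qpiW: x => s; elim/qpiW: y => t; rewrite -qpiM !completion_normE.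
by apply: csn_lim_le (cvgMn (cvg_csn (s := s)) (cvg_csn (s := t))) => n; exact: csnM.
Qed.

Lemma completion_norm_starM x :
  completion_norm (star x * x) = completion_norm x ^+ 2.
Proof.
elim/qpiW: x => s; rewrite -qpi_star -qpiM !completion_normE; apply: csn_limE.
rewrite expr2; have := cvgMn (cvg_csn (s := s)) (cvg_csn (s := s)).
apply: eq_cvgn => n.
by rewrite /= csn_starM expr2.
Qed.

Lemma completion_normN x : completion_norm (- x) = completion_norm x.
Proof. by rewrite -scaleN1r completion_normZ normcN normc1 mul1r. Qed.

Lemma to_completionB x y :
  to_completion (x - y) = to_completion x - to_completion y.
Proof.
by rewrite /to_completion -qpiN -qpiD; apply/qpi_eq/cs_eq_ext.
Qed.

Lemma to_completion_approx (s : preCompletion) (e : R) : 0 < e ->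
  exists N, forall n, (N <= n)%N ->
    completion_norm (qpi s - to_completion (sval s n)) <= e.
Proof.
move=> /(svalP s)[N sN]; exists N => n Nn.
rewrite /to_completion -qpiN -qpiD completion_normE.
apply: limr_le; first exact: is_cvg_csn.
by exists N => // m Nm /=; apply/ltW/sN.
Qed.

Lemma completion_dense x (e : R) : 0 < e ->
  exists a, completion_norm (x - to_completion a) <= e.
Proof.
elim/qpiW: x => s /(to_completion_approx s)[N H].
by exists (sval s N); apply: H.
Qed.

Lemma completion_norm_dist x y z :
  completion_norm (x - z) <= completion_norm (x - y) + completion_norm (y - z).
Proof. by rewrite (le_trans _ (completion_normD _ _))// addrA subrK. Qed.

Lemma completion_normBC x y : completion_norm (x - y) = completion_norm (y - x).
Proof. by rewrite -completion_normN opprB. Qed.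

Lemma completion_complete (u : nat -> completion) :
  (forall e : R, 0 < e -> exists N, forall m n, (N <= m)%N -> (N <= n)%N ->
    completion_norm (u m - u n) < e) ->
  exists l, (fun n => completion_norm (u n - l)) @ \oo --> (0 : R).
Proof.
move=> uc.
have /choice[a aP] : forall n, exists a,
    completion_norm (u n - to_completion a) <= n.+1%:R^-1.
  by move=> n; apply: completion_dense; rewrite invr_gt0.
have small (e : R) : 0 < e -> exists N, forall n, (N <= n)%N ->
    completion_norm (u n - to_completion (a n)) < e.
  move=> e0; have /cvgr0Pnorm_lt/(_ e e0)[N _ H] := @cvg_harmonic R.
  exists N => n Nn; apply: le_lt_trans (aP n) _.
  by have := H n Nn; rewrite /= ger0_norm// invr_ge0.
have ac : csn_cauchy a.
  move=> e e0; have e3 : 0 < e / 3 by rewrite divr_gt0.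
  have [N1 H1] := uc _ e3; have [N2 H2] := small _ e3.
  exists (maxn N1 N2) => m n; rewrite !geq_max => /andP[m1 m2] /andP[n1 n2].
  rewrite -to_completion_norm to_completionB.
  apply: le_lt_trans (completion_norm_dist _ (u m) _) _.
  rewrite (_ : e = e / 3 + (e / 3 + e / 3)); last by lra.
  rewrite ltrD//; first by rewrite completion_normBC H2.
  apply: le_lt_trans (completion_norm_dist _ (u n) _) _.
  by rewrite ltrD ?H1 ?H2.
exists (qpi (exist _ a ac : preCompletion)).
apply/cvgr0Pnorm_lt => e e0; have e2 : 0 < e / 2 by rewrite divr_gt0.
have [N1 H1] := small _ e2.
have [N2 H2] := to_completion_approx (exist _ a ac : preCompletion) e2.
exists (maxn N1 N2) => // n /=; rewrite geq_max => /andP[n1 n2].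
rewrite ger0_norm ?completion_norm_ge0//.
apply: le_lt_trans (completion_norm_dist _ (to_completion (a n)) _) _.
by rewrite [e]splitr ltr_leD ?H1// completion_normBC H2.
Qed.

HB.instance Definition _ := isCStarAlgebra.Build R completion
  completion_norm_ge0 completion_norm_eq0 completion_normD completion_normZ
  completion_normM completion_norm_starM completion_complete.

End Completion.

Record is_star_hom (R : realType) (A B : starAlgType R) (f : A -> B) : Prop :=
  IsStarHom {
    star_hom1 : f 1 = 1;
    star_homD : forall x y, f (x + y) = f x + f y;
    star_homZ : forall (c : R[i]) x, f (c *: x) = c *: f x;
    star_homM : forall x y, f (x * y) = f x * f y;
    star_homS : forall x, f (star x) = star (f x)
  }.

Lemma star_homB (R : realType) (A B : starAlgType R) (f : A -> B) x y :
  is_star_hom f -> f (x - y) = f x - f y.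
Proof.
by move=> fh; rewrite (star_homD fh) -scaleN1r (star_homZ fh) scaleN1r.
Qed.

Lemma to_completion_hom (R : realType) (O : starAlgType R)
  (p : cstarSeminorm O) : is_star_hom (to_completion p).
Proof.
split=> [|x y|c x|x y|x]; rewrite /to_completion -?qpiD -?qpiZ -?qpiM -?qpi_star //;
  by apply/qpi_eq/cs_eq_ext.
Qed.

Section StarHomSeminorm.
Context (R : realType) (O : starAlgType R) (B : cstarAlgType R).

Lemma cnorm1 : cnorm (1 : B) = 1.
Proof.
have H : cnorm (1 : B) ^+ 2 = cnorm (1 : B).
  by rewrite -cnorm_starM star1 mul1r.
have n0 : cnorm (1 : B) != 0.
  by apply/eqP => /cnorm_eq0/eqP; rewrite oner_eq0.
by apply: (mulfI n0); rewrite -expr2 H mulr1.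
Qed.

Definition cnorm_csn : cstarSeminorm B :=
  CStarSeminorm (@cnorm_ge0 R B) (@cnormD R B) (@cnormZ R B) (@cnormM R B)
    (@cnorm_starM R B) cnorm1.

Definition hom_csn (f : O -> B) (fh : is_star_hom f) : cstarSeminorm O.
Proof.
refine (@CStarSeminorm R O (fun x => cnorm (f x)) _ _ _ _ _ _).
- by move=> x; apply: cnorm_ge0.
- by move=> x y; rewrite (star_homD fh) cnormD.
- by move=> c x; rewrite (star_homZ fh) cnormZ.
- by move=> x y; rewrite (star_homM fh) cnormM.
- by move=> x; rewrite (star_homM fh) (star_homS fh) cnorm_starM.
- by rewrite (star_hom1 fh) cnorm1.
Defined.

End StarHomSeminorm.

(* The enveloping C*-algebra of [O]: the completion for the largest C*-seminorm.
   It exists when C*-seminorms on [O] are pointwise bounded, and is nonzero when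
   there is a nonzero one. *)
Section Envelope.
Context (R : realType) (O : starAlgType R) (p0 : cstarSeminorm O).
Context (bounded : forall a : O, exists M, forall p : cstarSeminorm O, p a <= M).

Definition env_norm (a : O) : R :=
  sup (range (fun p : cstarSeminorm O => p a)).

Lemma env_norm_has_sup a : has_sup (range (fun p : cstarSeminorm O => p a)).
Proof.
split; first by exists (p0 a), p0.
by have [M aM] := bounded a; exists M => _ [p _ <-].
Qed.

Lemma env_norm_ub a (p : cstarSeminorm O) : p a <= env_norm a.
Proof. by apply: (sup_upper_bound (env_norm_has_sup a)); exists p. Qed.

Lemma env_norm_le a r : (forall p : cstarSeminorm O, p a <= r) -> env_norm a <= r.
Proof.
move=> H; apply: ge_sup; first by exists (p0 a), p0.
by move=> _ [p _ <-].
Qed.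

Lemma env_norm_ge0 a : 0 <= env_norm a.
Proof. by rewrite (le_trans (csn_ge0 p0 a))// env_norm_ub. Qed.

Lemma env_normD x y : env_norm (x + y) <= env_norm x + env_norm y.
Proof.
by apply: env_norm_le => p; rewrite (le_trans (csnD _ _ _))// lerD ?env_norm_ub.
Qed.

Lemma env_normZ (c : R[i]) x : env_norm (c *: x) = normc c * env_norm x.
Proof.
have H (d : R[i]) y : env_norm (d *: y) <= normc d * env_norm y.
  by apply: env_norm_le => p; rewrite csnZ ler_wpM2l ?normc_ge0 ?env_norm_ub.
apply/le_anti; rewrite H/=.
have [->|c0] := eqVneq c 0; first by rewrite normc0 mul0r env_norm_ge0.
have nc : 0 < normc c.
  rewrite lt_neqAle normc_ge0 andbT eq_sym.
  by apply: contra c0 => /eqP/eq0_normc ->.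
rewrite mulrC -ler_pdivlMr// mulrC -normcV.
by rewrite (le_trans _ (H _ _))// scalerA mulVf// scale1r.
Qed.

Lemma env_normM x y : env_norm (x * y) <= env_norm x * env_norm y.
Proof.
apply: env_norm_le => p; rewrite (le_trans (csnM _ _ _))//.
by rewrite ler_pM ?csn_ge0 ?env_norm_ub.
Qed.

Lemma env_norm_starM x : env_norm (star x * x) = env_norm x ^+ 2.
Proof.
apply/le_anti/andP; split.
  apply: env_norm_le => p.
  by rewrite csn_starM ler_pXn2r ?nnegrE ?csn_ge0 ?env_norm_ge0 ?env_norm_ub.
rewrite -[leRHS]sqr_sqrtr ?env_norm_ge0//.
rewrite ler_pXn2r ?nnegrE ?sqrtr_ge0 ?env_norm_ge0//.
apply: env_norm_le => p.
by rewrite -[leLHS]ger0_norm ?csn_ge0// -sqrtr_sqr ler_wsqrtr// -csn_starM env_norm_ub.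
Qed.

Lemma env_norm1 : env_norm 1 = 1.
Proof.
apply/le_anti/andP; split; first by apply: env_norm_le => p; rewrite csn1.
by rewrite -[leLHS](csn1 p0) env_norm_ub.
Qed.

Definition env_csn : cstarSeminorm O :=
  CStarSeminorm env_norm_ge0 env_normD env_normZ env_normM env_norm_starM
    env_norm1.

Definition envelope : cstarAlgType R := completion env_csn.

Definition to_envelope : O -> envelope := to_completion env_csn.

Lemma to_envelope_hom : is_star_hom to_envelope.
Proof. exact: to_completion_hom. Qed.

Section Universal.
Context (B : cstarAlgType R) (f : O -> B) (fh : is_star_hom f).

Let ncB := cnorm_csn B.

Lemma hom_le_env x : cnorm (f x) <= env_norm x.
Proof. exact: (env_norm_ub x (hom_csn fh)). Qed.

Lemma hom_cauchy (s : nat -> O) :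
  csn_cauchy env_csn s -> csn_cauchy ncB (fun n => f (s n)).
Proof.
move=> sc; apply: csn_cauchy_le sc => m n.
by rewrite -(star_homB _ _ fh) hom_le_env.
Qed.

Definition hom_seq (s : cauchySeq env_csn) : cauchySeq ncB :=
  exist _ _ (hom_cauchy (svalP s)).

Lemma hom_seq_eq s t : cs_eq s t -> cs_eq (hom_seq s) (hom_seq t).
Proof.
by apply: null_seqW => n /=; rewrite -(star_homB _ _ fh); exact: hom_le_env.
Qed.

Lemma cs_cst_inj (x y : B) : cs_eq (cs_cst ncB x) (cs_cst ncB y) -> x = y.
Proof.
rewrite /cs_eq /null_seq /= => /(cvg_lim (@Rhausdorff R)).
by rewrite lim_cst// => /cnorm_eq0/eqP; rewrite subr_eq0 => /eqP.
Qed.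

Lemma hom_seq_cvg (s : cauchySeq env_csn) :
  exists l, cs_eq (hom_seq s) (cs_cst ncB l).
Proof. by have [l] := @cnorm_complete _ B _ (svalP (hom_seq s)); exists l. Qed.

Definition hom_lim (s : cauchySeq env_csn) : B := sval (cid (hom_seq_cvg s)).

Lemma hom_limP s : cs_eq (hom_seq s) (cs_cst ncB (hom_lim s)).
Proof. exact: svalP (cid (hom_seq_cvg s)). Qed.

Lemma hom_lim_eq s l : cs_eq (hom_seq s) (cs_cst ncB l) -> hom_lim s = l.
Proof.
by move=> sl; apply: cs_cst_inj; apply: cs_trans (cs_sym (hom_limP s)) sl.
Qed.

Definition env_lift (x : envelope) : B := hom_lim (repr x).

Lemma env_liftE (s : preCompletion env_csn) : env_lift (qpi s) = hom_lim s.
Proof.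
apply: hom_lim_eq; apply: cs_trans (hom_limP s).
by apply: hom_seq_eq; exact: (qrepr s).
Qed.

Lemma env_lift_to x : env_lift (to_envelope x) = f x.
Proof. by rewrite env_liftE; apply: hom_lim_eq; exact: cs_eq_ext. Qed.

Lemma env_lift_hom : is_star_hom env_lift.
Proof.
split=> [|x y|c x|x y|x].
- by rewrite -(star_hom1 to_envelope_hom) env_lift_to (star_hom1 fh).
- elim/qpiW: x => s; elim/qpiW: y => t; rewrite -qpiD !env_liftE.
  apply: hom_lim_eq; apply: cs_trans (cs_congr_add (hom_limP s) (hom_limP t)).
  by apply: cs_eq_ext => n /=; rewrite (star_homD fh).
- elim/qpiW: x => s; rewrite -qpiZ !env_liftE.
  apply: hom_lim_eq; apply: cs_trans (cs_congr_scale c (hom_limP s)).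
  by apply: cs_eq_ext => n /=; rewrite (star_homZ fh).
- elim/qpiW: x => s; elim/qpiW: y => t; rewrite -qpiM !env_liftE.
  apply: hom_lim_eq; apply: cs_trans (cs_congr_mul (hom_limP s) (hom_limP t)).
  by apply: cs_eq_ext => n /=; rewrite (star_homM fh).
- elim/qpiW: x => s; rewrite -qpi_star !env_liftE.
  apply: hom_lim_eq; apply: cs_trans (cs_congr_star (hom_limP s)).
  by apply: cs_eq_ext => n /=; rewrite (star_homS fh).
Qed.

Lemma env_lift_norm x : cnorm (env_lift x) <= cnorm x.
Proof.
elim/qpiW: x => s; rewrite env_liftE [leRHS]completion_normE.
have -> : cnorm (hom_lim s) = csn_lim (cs_cst ncB (hom_lim s)).
  by rewrite -[LHS](to_completion_norm ncB) completion_normE.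
rewrite -(csn_lim_eq (hom_limP s)).
apply: csn_lim_le (cvg_csn (s := s)) => n; exact: hom_le_env.
Qed.

End Universal.

(* The second condition on [g], which is automatic, makes uniqueness a
   consequence of density. *)
Theorem envelope_universal (B : cstarAlgType R) (f : O -> B) :
  is_star_hom f ->
  exists! g : envelope -> B, [/\ is_star_hom g,
    forall x, cnorm (g x) <= cnorm x & forall a, g (to_envelope a) = f a].
Proof.
move=> fh; exists (env_lift fh); split.
  split; [exact: env_lift_hom|exact: env_lift_norm|exact: env_lift_to].
move=> g [gh gle gf]; apply/funext => x.
apply/eqP; rewrite -subr_eq0; apply/eqP/cnorm_eq0/le_anti.
rewrite cnorm_ge0 andbT; apply/ler_addgt0Pl => e e0; rewrite addr0.
have e2 : 0 < e / 2 by rewrite divr_gt0.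
have [a xa] := completion_dense x e2.
have -> : env_lift fh x - g x =
    env_lift fh (x - to_envelope a) - g (x - to_envelope a).
  rewrite !(star_homB _ _ gh) !(star_homB _ _ (env_lift_hom fh)).
  by rewrite env_lift_to gf opprB addrA subrK.
rewrite (le_trans (csnB (cnorm_csn B) _ _))// [e]splitr lerD//=.
  by rewrite (le_trans (env_lift_norm _ _)).
by rewrite (le_trans (gle _)).
Qed.

End Envelope.

Local Close Scope classical_set_scope.

Record sgraph := SGraph {
  vertex :> finType;
  adj : rel vertex;
  adj_sym : symmetric adj;
  adj_irr : irreflexive adj;
  vertex_gt0 : (0 < #|vertex|)%N
}.

Section Graphs.
Implicit Types G H : sgraph.

Definition connected G := forall x y : G, connect (@adj G) x y.

Definition acyclic G :=
  forall c : seq G, (2 < size c)%N -> ~ ucycle (@adj G) c.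

Definition is_tree G := connected G /\ acyclic G.

Section Component.
Context (G : sgraph) (x : G).

Definition component_vertex := {y : G | connect (@adj G) x y}.

Definition component_adj : rel component_vertex :=
  fun y z => adj (val y) (val z).

Lemma component_adj_sym : symmetric component_adj.
Proof. by move=> y z; rewrite /component_adj adj_sym. Qed.

Lemma component_adj_irr : irreflexive component_adj.
Proof. by move=> y; rewrite /component_adj adj_irr. Qed.

Lemma component_gt0 : (0 < #|{: component_vertex}|)%N.
Proof. by apply/card_gt0P; exists (Sub x (connect0 _ x)). Qed.

(* The connected component of [x], as an induced subgraph. *)
Definition component : sgraph :=
  SGraph component_adj_sym component_adj_irr component_gt0.

End Component.

Definition is_forest G := forall x : G, is_tree (component x).

Definition isomorphic G H :=
  exists2 f : G -> H, bijective f & forall x y, adj (f x) (f y) = adj x y.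

Definition graph_aut G : {set {perm G}} :=
  [set s : {perm G} | [forall x, forall y, adj (s x) (s y) == adj x y]].

Lemma graph_autP G (s : {perm G}) :
  reflect (forall x y, adj (s x) (s y) = adj x y) (s \in graph_aut G).
Proof.
rewrite inE; apply: (iffP forallP) => [H x y|H x].
  by have /forallP/(_ y)/eqP := H x.
by apply/forallP => y; apply/eqP.
Qed.

Lemma graph_aut_group_set G : group_set (graph_aut G).
Proof.
apply/group_setP; split; first by apply/graph_autP => x y; rewrite !perm1.
move=> s t /graph_autP sG /graph_autP tG; apply/graph_autP => x y.
by rewrite !permM tG sG.
Qed.

Canonical graph_aut_group G := group (graph_aut_group_set G).

Definition asymmetric G := graph_aut G = 1%g.

Definition supp G (s : {perm G}) : {set G} := [set x | s x != x].

Definition schmidt_criterion G := exists s t : {perm G},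
  [/\ s \in graph_aut G, t \in graph_aut G, s != 1%g, t != 1%g &
      [disjoint supp s & supp t]].

End Graphs.

Section Magic.
Context (R : realType) (A : starAlgType R).

Definition is_projection (a : A) := star a = a /\ a * a = a.

Definition magic_unitary (I J : finType) (U : I -> J -> A) :=
  [/\ forall i j, is_projection (U i j),
      forall i, \sum_j U i j = 1 &
      forall j, \sum_i U i j = 1].

(* [U Adj(G) = Adj(H) U], entrywise. *)
Definition intertwines (H G : sgraph) (U : H -> G -> A) := forall h g,
  \sum_(g' : G) U h g' * (adj g' g)%:R = \sum_(h' : H) (adj h h')%:R * U h' g.

End Magic.

Definition quantum_isomorphic (R : realType) (G H : sgraph) :=
  #|G| = #|H| /\
  exists (X : cstarAlgType R) (U : H -> G -> X), magic_unitary U /\ intertwines U.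

Definition qu_relations (R : realType) (G : sgraph) (A : starAlgType R)
    (u : G -> G -> A) :=
  [/\ magic_unitary u,
      forall x y z, y != z -> u x y * u x z = 0 /\ u y x * u z x = 0 &
      intertwines u].

Inductive qterm (R : realType) (G : sgraph) :=
| TGen of G & G
| TZero
| TOne
| TOpp of qterm R G
| TAdd of qterm R G & qterm R G
| TMul of qterm R G & qterm R G
| TScale of R[i] & qterm R G
| TStar of qterm R G.

Arguments TGen {R G}.
Arguments TZero {R G}.
Arguments TOne {R G}.

Section QAut.
Context (R : realType) (G : sgraph).

Local Notation T := (qterm R G).
Local Notation u := (@TGen R G).
Local Notation nat_term n := (TScale (n%:R : R[i]) TOne : T).

HB.instance Definition _ := gen_eqMixin (qterm R G).
HB.instance Definition _ := gen_choiceMixin (qterm R G).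

(* The least congruence containing the relations [qu_relations] and the axioms
   of unital complex *-algebras; [OQu], its quotient, is O(Qu(G)). *)
Inductive qrel : T -> T -> Prop :=
| qrel_proj_star x y : qrel (TStar (u x y)) (u x y)
| qrel_proj_idem x y : qrel (TMul (u x y) (u x y)) (u x y)
| qrel_row x : qrel (\big[@TAdd R G/TZero]_(y : G) u x y) TOne
| qrel_col x : qrel (\big[@TAdd R G/TZero]_(y : G) u y x) TOne
| qrel_orth_row x y z : y != z -> qrel (TMul (u x y) (u x z)) TZero
| qrel_orth_col x y z : y != z -> qrel (TMul (u y x) (u z x)) TZero
| qrel_adj x z :
    qrel (\big[@TAdd R G/TZero]_(y : G) TMul (u x y) (nat_term (adj y z)))
         (\big[@TAdd R G/TZero]_(y : G) TMul (nat_term (adj x y)) (u y z))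
| qrel_refl s : qrel s s
| qrel_sym s t : qrel s t -> qrel t s
| qrel_trans s t r : qrel s t -> qrel t r -> qrel s r
| qrel_congr_opp s s' : qrel s s' -> qrel (TOpp s) (TOpp s')
| qrel_congr_add s s' t t' :
    qrel s s' -> qrel t t' -> qrel (TAdd s t) (TAdd s' t')
| qrel_congr_mul s s' t t' :
    qrel s s' -> qrel t t' -> qrel (TMul s t) (TMul s' t')
| qrel_congr_scale c s s' : qrel s s' -> qrel (TScale c s) (TScale c s')
| qrel_congr_star s s' : qrel s s' -> qrel (TStar s) (TStar s')
| qrel_addA s t r : qrel (TAdd s (TAdd t r)) (TAdd (TAdd s t) r)
| qrel_addC s t : qrel (TAdd s t) (TAdd t s)
| qrel_add0 s : qrel (TAdd TZero s) s
| qrel_addN s : qrel (TAdd (TOpp s) s) TZero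
| qrel_mulA s t r : qrel (TMul s (TMul t r)) (TMul (TMul s t) r)
| qrel_mul1l s : qrel (TMul TOne s) s
| qrel_mul1r s : qrel (TMul s TOne) s
| qrel_mulDl s t r : qrel (TMul (TAdd s t) r) (TAdd (TMul s r) (TMul t r))
| qrel_mulDr s t r : qrel (TMul s (TAdd t r)) (TAdd (TMul s t) (TMul s r))
| qrel_scaleA a b s : qrel (TScale a (TScale b s)) (TScale (a * b) s)
| qrel_scale1 s : qrel (TScale 1 s) s
| qrel_scaleDr a s t :
    qrel (TScale a (TAdd s t)) (TAdd (TScale a s) (TScale a t))
| qrel_scaleDl a b s :
    qrel (TScale (a + b) s) (TAdd (TScale a s) (TScale b s))
| qrel_scaleAl a s t : qrel (TScale a (TMul s t)) (TMul (TScale a s) t)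
| qrel_scaleAr a s t : qrel (TScale a (TMul s t)) (TMul s (TScale a t))
| qrel_starK s : qrel (TStar (TStar s)) s
| qrel_starD s t : qrel (TStar (TAdd s t)) (TAdd (TStar s) (TStar t))
| qrel_starZ a s : qrel (TStar (TScale a s)) (TScale a^*%C (TStar s))
| qrel_starM s t : qrel (TStar (TMul s t)) (TMul (TStar t) (TStar s)).

Section Eval.
Context (A : starAlgType R) (v : G -> G -> A).

Fixpoint qeval (t : T) : A :=
  match t with
  | TGen x y => v x y
  | TZero => 0
  | TOne => 1
  | TOpp s => - qeval s
  | TAdd s t => qeval s + qeval t
  | TMul s t => qeval s * qeval t
  | TScale c s => c *: qeval s
  | TStar s => star (qeval s)
  end.

Lemma qeval_sum (F : G -> T) :
  qeval (\big[@TAdd R G/TZero]_(y : G) F y) = \sum_(y : G) qeval (F y).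
Proof. exact: (big_morph qeval). Qed.

Lemma qeval_rel (vr : qu_relations v) s t : qrel s t -> qeval s = qeval t.
Proof.
case: vr => -[proj row col] orth inter.
elim=> /=; try by (intros; congruence).
- by move=> x y; have [] := proj x y.
- by move=> x y; have [] := proj x y.
- by move=> x; rewrite qeval_sum; exact: row.
- by move=> x; rewrite qeval_sum; exact: col.
- by move=> x y z /(orth x)[].
- by move=> x y z /(orth x)[].
- move=> x z; rewrite !qeval_sum /=.
  under eq_bigr do rewrite scaler_nat.
  by under [RHS]eq_bigr do rewrite scaler_nat.
- by move=> *; rewrite addrA.
- by move=> *; rewrite addrC.
- by move=> *; rewrite add0r.
- by move=> *; rewrite addNr.
- by move=> *; rewrite mulrA.
- by move=> *; rewrite mul1r.
- by move=> *; rewrite mulr1.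
- by move=> *; rewrite mulrDl.
- by move=> *; rewrite mulrDr.
- by move=> *; rewrite scalerA.
- by move=> *; rewrite scale1r.
- by move=> *; rewrite scalerDr.
- by move=> *; rewrite scalerDl.
- by move=> *; rewrite scalerAl.
- by move=> *; rewrite scalerAr.
- by move=> *; rewrite starK.
- by move=> *; rewrite starD.
- by move=> *; rewrite starZ.
- by move=> *; rewrite starM.
Qed.

End Eval.

Fixpoint qcounit (t : T) : R[i] :=
  match t with
  | TGen x y => (x == y)%:R
  | TZero => 0
  | TOne => 1
  | TOpp s => - qcounit s
  | TAdd s t => qcounit s + qcounit t
  | TMul s t => qcounit s * qcounit t
  | TScale c s => c * qcounit s
  | TStar s => (qcounit s)^*%C
  end.

Lemma qcounit_sum (F : G -> T) :
  qcounit (\big[@TAdd R G/TZero]_(y : G) F y) = \sum_(y : G) qcounit (F y).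
Proof. exact: (big_morph qcounit). Qed.

Lemma qcounit_rel s t : qrel s t -> qcounit s = qcounit t.
Proof.
have row (x : G) (F : G -> R[i]) : \sum_(y : G) (x == y)%:R * F y = F x.
  rewrite (bigD1 x)//= eqxx mul1r big1 ?addr0// => y yx.
  by rewrite eq_sym (negbTE yx) mul0r.
elim=> /=; try by (intros; congruence).
- by move=> x y; rewrite rmorph_nat.
- by move=> x y; rewrite -natrM mulnb andbb.
- move=> x; rewrite qcounit_sum /= -[RHS](row x (fun=> 1)).
  by apply: eq_bigr => y _; rewrite mulr1.
- move=> x; rewrite qcounit_sum /= -[RHS](row x (fun=> 1)).
  by apply: eq_bigr => y _; rewrite mulr1 eq_sym.
- move=> x y z yz; rewrite -natrM mulnb.
  case: (x =P y) => //= xy; case: (x =P z) => //= xz.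
  by rewrite -xy -xz eqxx in yz.
- move=> x y z yz; rewrite -natrM mulnb.
  case: (y =P x) => //= xy; case: (z =P x) => //= xz.
  by rewrite xy xz eqxx in yz.
- move=> x z; rewrite !qcounit_sum /=.
  rewrite (row x (fun y => (adj y z)%:R * 1)) mulr1.
  rewrite -(row z (fun y => (adj x y)%:R)).
  by apply: eq_bigr => y _; rewrite mulr1 eq_sym mulrC.
- by move=> *; rewrite addrA.
- by move=> *; rewrite addrC.
- by move=> *; rewrite add0r.
- by move=> *; rewrite addNr.
- by move=> *; rewrite mulrA.
- by move=> *; rewrite mul1r.
- by move=> *; rewrite mulr1.
- by move=> *; rewrite mulrDl.
- by move=> *; rewrite mulrDr.
- by move=> *; rewrite mulrA.
- by move=> *; rewrite mul1r.
- by move=> *; rewrite mulrDr.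
- by move=> *; rewrite mulrDl.
- by move=> *; rewrite mulrA.
- by move=> *; rewrite mulrCA.
- by move=> *; rewrite conjcK.
- by move=> *; rewrite rmorphD.
- by move=> *; rewrite rmorphM.
- by move=> *; rewrite rmorphM mulrC.
Qed.

Lemma qrel_neq : ~ qrel TOne TZero.
Proof. by move/qcounit_rel => /= /eqP; rewrite oner_eq0. Qed.

Definition preOQu : preStarAlg R :=
  PreStarAlg qrel_refl qrel_sym qrel_trans qrel_congr_opp qrel_congr_add
    qrel_congr_mul qrel_congr_scale qrel_congr_star qrel_addA qrel_addC
    qrel_add0 qrel_addN qrel_mulA qrel_mul1l qrel_mul1r qrel_mulDl qrel_mulDr
    qrel_scaleA qrel_scale1 qrel_scaleDr qrel_scaleDl qrel_scaleAl qrel_scaleAr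
    qrel_starK qrel_starD qrel_starZ qrel_starM qrel_neq.

Definition OQu : starAlgType R := quot preOQu.

Definition OQu_gen (x y : G) : OQu := qpi (u x y : preOQu).

Lemma OQu_sum (F : G -> T) :
  (qpi (\big[@TAdd R G/TZero]_(y : G) F y : preOQu) : OQu) =
  \sum_(y : G) (qpi (F y : preOQu) : OQu).
Proof.
by apply: (big_morph (fun t : T => (qpi (t : preOQu) : OQu))) => // s t;
  exact: (qpiD (s : preOQu) t).
Qed.

Lemma OQu_nat n : (qpi (nat_term n : preOQu) : OQu) = n%:R.
Proof.
by rewrite (qpiZ (n%:R) (TOne : preOQu)) (qpi1 preOQu) scaler_nat.
Qed.

Lemma OQu_relations : qu_relations OQu_gen.
Proof.
split; first split.
- move=> x y; split.
    by rewrite -qpi_star; apply/qpi_eq/qrel_proj_star.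
  by rewrite -qpiM; apply/qpi_eq/qrel_proj_idem.
- by move=> x; rewrite -OQu_sum; apply/qpi_eq/qrel_row.
- by move=> x; rewrite -OQu_sum; apply/qpi_eq/qrel_col.
- move=> x y z yz; split; rewrite -qpiM.
    exact/qpi_eq/qrel_orth_row.
  exact/qpi_eq/qrel_orth_col.
- move=> x z.
  under eq_bigr do rewrite -OQu_nat -qpiM.
  under [RHS]eq_bigr do rewrite -OQu_nat -qpiM.
  by rewrite -!OQu_sum; apply/qpi_eq/qrel_adj.
Qed.

Theorem OQu_universal (A : starAlgType R) (v : G -> G -> A) :
  qu_relations v ->
  exists! f : OQu -> A, is_star_hom f /\ forall x y, f (OQu_gen x y) = v x y.
Proof.
move=> vr; pose f (a : OQu) : A := qeval v (repr a).
have fE (t : preOQu) : f (qpi t) = qeval v t by apply: qeval_rel => //; apply: (qrepr t).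
exists f; split.
  split; last by move=> x y; rewrite fE.
  split=> [|a b|c a|a b|a].
  - by rewrite -(qpi1 preOQu) fE.
  - by elim/qpiW: a => a; elim/qpiW: b => b; rewrite -qpiD !fE.
  - by elim/qpiW: a => a; rewrite -qpiZ !fE.
  - by elim/qpiW: a => a; elim/qpiW: b => b; rewrite -qpiM !fE.
  - by elim/qpiW: a => a; rewrite -qpi_star !fE.
move=> g [gh gv]; apply/funext; elim/qpiW => t; rewrite fE; apply/esym.
elim: t => [x y|||s IHs|s IHs t IHt|s IHs t IHt|c s IHs|s IHs].
- exact: gv.
- rewrite (qpi0 preOQu) -(subrr (1 : OQu)) (star_homB _ _ gh) subrr//.
- by rewrite (qpi1 preOQu) (star_hom1 gh).
- by rewrite (qpiN (s : preOQu)) -scaleN1r (star_homZ gh) scaleN1r IHs.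
- by rewrite (qpiD (s : preOQu) t) (star_homD gh) IHs IHt.
- by rewrite (qpiM (s : preOQu) t) (star_homM gh) IHs IHt.
- by rewrite (qpiZ c (s : preOQu)) (star_homZ gh) IHs.
- by rewrite (qpi_star (s : preOQu)) (star_homS gh) IHs.
Qed.

Definition counit_csn : cstarSeminorm OQu.
Proof.
pose e (a : OQu) : R[i] := qcounit (repr a).
have eE (t : preOQu) : e (qpi t) = qcounit t by apply: qcounit_rel; apply: (qrepr t).
refine (@CStarSeminorm R OQu (fun a => normc (e a)) _ _ _ _ _ _).
- by move=> a; exact: normc_ge0.
- elim/qpiW=> a; elim/qpiW=> b; rewrite -qpiD !eE /=.
  by have := ler_normD (qcounit a) (qcounit b); rewrite -lecR rmorphD.
- by move=> c; elim/qpiW=> a; rewrite -qpiZ !eE /= normcM.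
- by elim/qpiW=> a; elim/qpiW=> b; rewrite -qpiM !eE /= normcM.
- elim/qpiW=> a; rewrite -qpi_star -qpiM !eE /= normcM expr2; congr (_ * _).
  by case: (qcounit a) => x y; rewrite /normc /= sqrrN.
- by rewrite -(qpi1 preOQu) eE normc1.
Defined.

(* In a C*-seminorm the generators, being projections, have norm at most 1. *)
Fixpoint qbound (t : T) : R :=
  match t with
  | TGen _ _ => 1
  | TZero => 0
  | TOne => 1
  | TOpp s => qbound s
  | TAdd s t => qbound s + qbound t
  | TMul s t => qbound s * qbound t
  | TScale c s => normc c * qbound s
  | TStar s => qbound s
  end.

Lemma OQu_bounded (a : OQu) : exists M, forall p : cstarSeminorm OQu, p a <= M.
Proof.
elim/qpiW: a => t; exists (qbound t) => p.
elim: t => [x y|||s IHs|s IHs t IHt|s IHs t IHt|c s IHs|s IHs] /=.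
- have [[proj _ _] _ _] := OQu_relations.
  have [sx xx] := proj x y; rewrite -/(OQu_gen x y).
  have := csn_starM p (OQu_gen x y); rewrite sx xx.
  have [->|n0] := eqVneq (p (OQu_gen x y)) 0; first by rewrite ler01.
  move=> H; have -> // : p (OQu_gen x y) = 1.
  by apply: (mulfI n0); rewrite mulr1 -expr2 -H.
- by rewrite (qpi0 preOQu) csn0.
- by rewrite (qpi1 preOQu) csn1.
- by rewrite (qpiN (s : preOQu)) csnN.
- by rewrite (qpiD (s : preOQu) t) (le_trans (csnD _ _ _))// lerD.
- by rewrite (qpiM (s : preOQu) t) (le_trans (csnM _ _ _))// ler_pM ?csn_ge0.
- by rewrite (qpiZ c (s : preOQu)) csnZ ler_wpM2l ?normc_ge0.
- by rewrite (qpi_star (s : preOQu)) csn_star.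
Qed.

Definition CQu : cstarAlgType R := envelope counit_csn OQu_bounded.

(* O(Qu(G)) = C: the unit map is an isomorphism. *)
Definition trivial_Qu := bijective (fun c : R[i] => c *: (1 : OQu)).

Definition has_quantum_symmetry := ~ (forall a b : CQu, a * b = b * a).

End QAut.

(* Main.v *)
Require Import Defs.
From HB Require Import structures.
From mathcomp Require Import boolp classical_sets reals.
From mathcomp Require Import all_boot all_order all_algebra.
From mathcomp Require Import fingroup perm.
From mathcomp Require Import complex.
From mathcomp Require Import ring lra.

(* A magic unitary [U] intertwining the adjacency matrices of [H] and [G] groups
   the vertices into classes, generated by [h ~ g] when [U h g <> 0]. These
   classes are equitable: vertices of one class have the same number of
   neighbours in every class. In forests, a class-preserving isomorphism can be
   built greedily from any matched pair of vertices, since acyclicity leaves a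
   single edge to check at each step. Hence quantum isomorphic forests are
   isomorphic and the classes of O(Qu(G)) are orbits of automorphisms; if [G] is
   asymmetric, they are singletons and [u] is the identity matrix.

   If a forest fails Schmidt's criterion, then its moved vertices fall, along
   the edges joining distinct classes, into at most three isomorphic copies of
   one piece, each meeting every nontrivial class exactly once: otherwise one
   cuts out two automorphisms with disjoint supports. The entries of [u] are then
   those of a single magic unitary of size at most 3, and these commute.
   Conversely, automorphisms [s], [t] with disjoint supports and projections [p],
   [q] give the magic unitary [(p + (1 - p) s) (q + (1 - q) t)], and [p], [q] can
   be taken to be noncommuting 2x2 matrices. *)

Set Implicit Arguments.
Unset Strict Implicit.
Unset Printing Implicit Defensive.

Import Order.TTheory GRing.Theory Num.Theory.
Import ComplexField.Normc.

(** * Greedy isomorphisms of coloured forests *)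

Section Acyclic.
Variable G : sgraph.
Implicit Types (S : {set G}) (x y : G).

Lemma adj_connect_sym : connect_sym (@adj G).
Proof. exact/sym_connect_sym/adj_sym. Qed.

(** A cycle stays in the component of its first vertex, so it lifts to the subtype underlying
    [component x]. *)
Lemma forest_acyclic : is_forest G -> acyclic G.
Proof.
move=> fG [|x p] // sz /andP[cy un].
have [_ ac] := fG x.
have all_conn : all (connect (@adj G) x) (x :: p).
  apply/allP => y; rewrite inE => /orP[/eqP->//|yp].
  move: cy; rewrite /= rcons_path => /andP[pp _].
  by apply: (path_connect pp); rewrite inE yp orbT.
have [s sE] : exists s : seq (component x), map val s = x :: p.
  move: all_conn; elim: (x :: p) => [|y q IH] /=; first by exists [::].
  by move=> /andP[yx /IH[s <-]]; exists (exist _ y yx :: s).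
apply: (ac s); first by rewrite -(size_map val) sE.
rewrite /ucycle -(map_inj_uniq val_inj) sE un andbT.
move: cy; rewrite -sE; case: (s) => [//|z s'] /=.
by rewrite -map_rcons path_map.
Qed.

Hypothesis acG : acyclic G.

(** An [e]-path from [x] to [y], once made simple, has at least two edges because [e x y] fails; the
    edge from [y] back to [x] closes it into a cycle. *)
Lemma acyclic_edge (e : rel G) x y :
  subrel e (@adj G) -> adj x y -> ~~ e x y -> ~~ connect e x y.
Proof.
move=> sub xy nexy; apply/negP => /connectP[p0 p0p lasty].
case/shortenP: p0p lasty => p pp un _ lasty.
apply: (acG (c := x :: p)).
  case: p pp {un} lasty => [|z [|w p]] //=.
    by move=> _ yx; rewrite yx adj_irr in xy.
  by rewrite andbT => exz yz; rewrite yz exz in nexy.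
rewrite /ucycle un andbT /= rcons_path -lasty adj_sym xy andbT.
exact: sub_path pp.
Qed.

(** A relation on all of [G] rather than a subgraph, so that [S] can grow without a change of type.
    Its [connect] is reflexive outside [S] too. *)
Definition induced_adj S : rel G :=
  fun x y => [&& x \in S, y \in S & adj x y].

Lemma induced_adj_sym S : symmetric (induced_adj S).
Proof. by move=> x y; rewrite /induced_adj adj_sym andbCA. Qed.

Lemma induced_connect_sym S : connect_sym (induced_adj S).
Proof. exact/sym_connect_sym/induced_adj_sym. Qed.

Lemma induced_adjS S1 S2 : S1 \subset S2 ->
  subrel (connect (induced_adj S1)) (connect (induced_adj S2)).
Proof.
move=> /subsetP S12; apply: connect_sub => x y /and3P[xS yS xy].
by apply: connect1; rewrite /induced_adj !S12.
Qed.

Lemma induced_connect_adj S :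
  subrel (connect (induced_adj S)) (connect (@adj G)).
Proof. by apply: connect_sub => x y /and3P[_ _ xy]; apply: connect1. Qed.

Lemma induced_connect_in S x y :
  connect (induced_adj S) x y -> x \in S -> y \in S.
Proof.
move=> xy xS; rewrite -(@closed_connect _ (induced_adj S) (mem S) _ x y) //.
by move=> u v /and3P[-> ->].
Qed.

(* Each component of [G] meets [S] in a connected induced subgraph. *)
Definition comp_connected S := {in S &, forall x y,
  connect (@adj G) x y -> connect (induced_adj S) x y}.

(** Here acyclicity leaves a single edge to check. Through [z] both neighbours lie in one component
    of [G], so a path inside [S], avoiding [z], joins them; for distinct neighbours it would close
    to a cycle through [z]. *)
Lemma unique_neighbour S x y z : comp_connected S ->
  x \in S -> y \in S -> z \notin S -> adj x z -> adj y z -> x = y.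
Proof.
move=> conn xS yS zS xz yz; apply/eqP/negPn/negP => xy.
(* Only the direction from [x] to [z] is removed, which is all that [acyclic_edge] asks for. *)
pose e := [rel u v | adj u v && ~~ ((u == x) && (v == z))].
have : ~~ connect e x z.
  apply: acyclic_edge => //=; last by rewrite !eqxx andbF.
  by move=> u v /andP[].
move=> /negP; apply; apply: (@connect_trans _ _ y).
  have : connect (induced_adj S) x y.
    apply: conn => //; apply: (@connect_trans _ _ z); first exact: connect1.
    by rewrite adj_connect_sym; apply: connect1.
  apply: connect_sub => u v /and3P[uS vS uv]; apply: connect1 => /=.
  rewrite uv /=; apply: contra zS => /andP[_ /eqP <-] //.
by apply: connect1; rewrite /= yz /= (negbTE (_ : y != x)) // eq_sym.
Qed.

Lemma comp_connected_nbr S x y : comp_connected S ->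
  x \in S -> adj x y -> comp_connected (y |: S).
Proof.
move=> conn xS xy.
have yx : connect (induced_adj (y |: S)) y x.
  by apply: connect1; rewrite /induced_adj adj_sym xy !inE eqxx xS orbT.
have from_y z : z \in S -> connect (@adj G) y z ->
    connect (induced_adj (y |: S)) y z.
  move=> zS yz; apply: connect_trans yx _.
  apply: (induced_adjS (subsetUr _ _)); apply: conn => //.
  by apply: connect_trans yz; apply: connect1.
move=> u v; rewrite !inE => /predU1P[->|uS] /predU1P[->|vS] uv.
- exact: connect0.
- exact: from_y.
- by rewrite induced_connect_sym; apply: from_y; rewrite // adj_connect_sym.
- by apply: (induced_adjS (subsetUr _ _)); apply: conn.
Qed.

Lemma comp_connected_new S y : comp_connected S ->
  {in S, forall x, ~~ connect (@adj G) x y} -> comp_connected (y |: S).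
Proof.
move=> conn new u v; rewrite !inE => /predU1P[->|uS] /predU1P[->|vS] uv.
- exact: connect0.
- by rewrite adj_connect_sym in uv; have := new _ vS; rewrite uv.
- by have := new _ uS; rewrite uv.
- by apply: (induced_adjS (subsetUr _ _)); apply: conn.
Qed.

End Acyclic.

(** * Extending partial isomorphisms one vertex at a time *)

Section Extension.
Variables (H G : sgraph) (T : eqType) (cH : H -> T) (cG : G -> T).
Hypotheses (acH : acyclic H) (acG : acyclic G).
Hypothesis nbr_eq : forall h g k, cH h = cG g ->
  #|[set x | adj h x & cH x == k]| = #|[set y | adj g y & cG y == k]|.
Hypothesis card_eq : forall k,
  #|[set x | cH x == k]| = #|[set y | cG y == k]|.

(** The map is total, but only its values on [S] count. The last two fields make [unique_neighbour]
    applicable on both sides. *)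
Record partial_iso (S : {set H}) (f : H -> G) : Prop := PartialIso {
  piso_col : {in S, forall x, cG (f x) = cH x};
  piso_adj : {in S &, forall x y, adj (f x) (f y) = adj x y};
  piso_inj : {in S &, injective f};
  piso_dom : comp_connected S;
  piso_img : comp_connected (f @: S)
}.

Lemma card_setD_image (I J : finType) (f : I -> J) (S A : {set I}) (B : {set J}) :
  #|A| = #|B| -> {in S &, injective f} -> {in S, forall x, (f x \in B) = (x \in A)} ->
  #|A :\: S| = #|B :\: f @: S|.
Proof.
move=> cAB finj fAB.
have E : B :&: f @: S = f @: (A :&: S).
  apply/setP => y; rewrite inE; apply/andP/imsetP.
    move=> [yB /imsetP[x xS yE]]; exists x => //.
    by rewrite inE xS andbT -fAB // -yE.
  move=> [x]; rewrite inE => /andP[xA xS] ->; split; first by rewrite fAB.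
  exact: imset_f.
have cI : #|A :&: S| = #|B :&: f @: S|.
  rewrite E card_in_imset // => u v.
  by rewrite !inE => /andP[_ uS] /andP[_ vS]; apply: finj.
by apply/eqP; rewrite -(eqn_add2l #|A :&: S|) cardsID cI cardsID cAB.
Qed.

Lemma setD_image_witness (I J : finType) (f : I -> J) (S A : {set I}) (B : {set J}) x :
  #|A| = #|B| -> {in S &, injective f} -> {in S, forall x, (f x \in B) = (x \in A)} ->
  x \in A -> x \notin S -> exists2 y, y \in B & y \notin f @: S.
Proof.
move=> cAB finj fAB xA xS.
have /card_gt0P[y] : 0 < #|B :\: f @: S|.
  by rewrite -(card_setD_image cAB finj fAB); apply/card_gt0P; exists x; rewrite inE xS.
by rewrite inE => /andP[? ?]; exists y.
Qed.

Lemma setD_image_witness_inv (I J : finType) (f : I -> J) (S A : {set I}) (B : {set J}) y :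
  #|A| = #|B| -> {in S &, injective f} -> {in S, forall x, (f x \in B) = (x \in A)} ->
  y \in B -> y \notin f @: S -> exists2 x, x \in A & x \notin S.
Proof.
move=> cAB finj fAB yB yS.
have /card_gt0P[x] : 0 < #|A :\: S|.
  by rewrite (card_setD_image cAB finj fAB); apply/card_gt0P; exists y; rewrite inE yS.
by rewrite inE => /andP[? ?]; exists x.
Qed.

Lemma partial_iso_extend S f x y : partial_iso S f ->
  x \notin S -> y \notin f @: S -> cG y = cH x ->
  {in S, forall z, adj (f z) y = adj z x} ->
  comp_connected (x |: S) -> comp_connected (y |: f @: S) ->
  exists2 f', partial_iso (x |: S) f' & {in S, f' =1 f}.
Proof.
move=> [fc fa fi _ _] xS yS cyx axy connS connT.
pose f' z := if z == x then y else f z.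
have f'x : f' x = y by rewrite /f' eqxx.
have f'S : {in S, f' =1 f}.
  by move=> z zS; rewrite /f'; case: eqP => // zx; rewrite -zx zS in xS.
exists f' => //; split.
- by move=> z; rewrite !inE => /predU1P[->|zS]; rewrite ?f'x // f'S // fc.
- move=> u v; rewrite !inE => /predU1P[->|uS] /predU1P[->|vS]; rewrite ?f'x ?f'S ?fa //.
  + by rewrite !adj_irr.
  + by rewrite adj_sym axy // adj_sym.
  + by rewrite axy.
- move=> u v; rewrite !inE => /predU1P[->|uS] /predU1P[->|vS]; rewrite ?f'x ?f'S //.
  + by move=> yE; rewrite yE imset_f in yS.
  + by move=> yE; rewrite -yE imset_f in yS.
  + exact: fi.
- exact: connS.
- rewrite imsetU1 f'x.
  suff -> : f' @: S = f @: S by [].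
  exact: eq_in_imset.
Qed.

Lemma partial_iso_step S f x0 : partial_iso S f -> x0 \notin S ->
  exists x f', [/\ x \notin S, partial_iso (x |: S) f' & {in S, f' =1 f}].
Proof.
move=> pf x0S; have [fc fa fi connS connT] := pf.
pose NH h k := [set x | adj h x & cH x == k].
pose NG g k := [set y | adj g y & cG y == k].
have NHG h k : h \in S -> #|NH h k| = #|NG (f h) k|.
  by move=> hS; apply: nbr_eq; rewrite fc.
have NHf h k : h \in S -> {in S, forall x, (f x \in NG (f h) k) = (x \in NH h k)}.
  by move=> hS x xS; rewrite !inE fa // fc.
have [/existsP[h /existsP[x /and3P[hS xS hx]]]|] :=
    boolP [exists h, exists x, [&& h \in S, x \notin S & adj h x]].
  have [|y] := setD_image_witness (NHG h (cH x) hS) fi (NHf h (cH x) hS) _ xS.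
    by rewrite inE hx eqxx.
  rewrite inE => /andP[hy /eqP cy] yS.
  have [|||f' pf' ff'] := partial_iso_extend pf xS yS cy; last by exists x, f'.
  - move=> z zS; apply/idP/idP => zx.
      suff -> : z = h by [].
      by apply: (fi) => //; apply: (unique_neighbour acG connT) yS _ _ => //; apply: imset_f.
    suff -> : z = h by [].
    by apply: (unique_neighbour acH connS) xS _ _.
  - exact: comp_connected_nbr hx.
  - by apply: comp_connected_nbr hy => //; apply: imset_f.
move=> clS.
have closedS z w : z \in S -> adj z w -> w \in S.
  move=> zS zw; apply/negPn/negP => wS; move/negP: clS; apply.
  by apply/existsP; exists z; apply/existsP; exists w; rewrite zS wS zw.
(* By the same count, a neighbour of [f h] outside the image would leave a neighbour of [h] outside
   [S]. *)
have closedT z w : z \in f @: S -> adj z w -> w \in f @: S.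
  move=> /imsetP[h hS ->] hw; apply/negPn/negP => wS.
  have [|x] := setD_image_witness_inv (NHG h (cG w) hS) fi (NHf h (cG w) hS) _ wS.
    by rewrite inE hw eqxx.
  by rewrite inE => /andP[hx _]; rewrite (closedS _ _ hS hx).
have [||y] := @setD_image_witness _ _ f S [set x | cH x == cH x0] [set y | cG y == cH x0] x0
    (card_eq _) fi _ _ x0S.
- by move=> x xS; rewrite !inE fc.
- by rewrite inE.
rewrite inE => /eqP cy yS.
have conn_closed (K : sgraph) (X : {set K}) z w :
    (forall u v, u \in X -> adj u v -> v \in X) -> z \in X -> w \notin X ->
    ~~ connect (@adj K) z w.
  move=> clX zX; apply: contra => zw.
  rewrite -(@closed_connect _ (@adj K) (mem X) _ z w) //.
  by apply: intro_closed; [exact: adj_connect_sym|move=> u v uv uX; apply: clX uv].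
have [|||f' pf' ff'] := partial_iso_extend pf x0S yS cy; last by exists x0, f'.
- move=> z zS; have /negbTE -> : ~~ adj z x0 by apply: contra x0S; apply: closedS.
  by apply/negbTE; apply: contra yS; apply: closedT; apply: imset_f.
- by apply: comp_connected_new => // z zS; apply: (conn_closed _ S).
- by apply: comp_connected_new => // z zS; apply: (conn_closed _ (f @: S)).
Qed.

(** Induction on the number of unmatched vertices, starting from the single pair [h0], [g0]. *)
Theorem coloured_forest_iso h0 g0 : cH h0 = cG g0 ->
  exists f : H -> G, [/\ bijective f, forall x y, adj (f x) (f y) = adj x y,
    forall x, cG (f x) = cH x & f h0 = g0].
Proof.
move=> c0.
suff ext n : forall S f, #|~: S| <= n -> h0 \in S -> f h0 = g0 -> partial_iso S f ->
    exists2 f', partial_iso setT f' & f' h0 = g0.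
  have [|f' [fc fa fi _ _] f0] := ext #|~: [set h0]| [set h0] (fun=> g0) (leqnn _) (set11 _) erefl.
    split.
    - by move=> x; rewrite inE => /eqP->.
    - by move=> x y; rewrite !inE => /eqP-> /eqP->; rewrite !adj_irr.
    - by move=> x y; rewrite !inE => /eqP-> /eqP->.
    - by move=> x y; rewrite !inE => /eqP-> /eqP-> _; apply: connect0.
    - move=> x y /imsetP[? _ ->] /imsetP[? _ ->] _; apply: connect0.
  have finj : injective f' by move=> x y; apply: fi; rewrite inE.
  exists f'; split=> //; last by move=> x; apply: fc; rewrite inE.
    apply: inj_card_bij => //; rewrite leqNgt; apply/negP => lt.
    (* Colour classes have equal sizes, so a vertex missed by [f'] would leave a vertex of [H]
       outside the full domain. *)
    have [g gP] : exists g, g \notin f' @: setT.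
      apply/existsP; rewrite -negb_forall; apply/negP => /forallP all.
      move: lt; rewrite ltnNge => /negP; apply.
      rewrite -[leqRHS]cardsT -(card_imset setT finj); apply/subset_leq_card.
      by apply/subsetP => g _; apply: all.
    have [||x _] := @setD_image_witness_inv _ _ f' setT [set x | cH x == cG g]
      [set y | cG y == cG g] g (card_eq _) fi _ _ gP; rewrite ?inE //.
    by move=> x xS; rewrite !inE fc.
  by move=> x y; apply: fa; rewrite inE.
elim: n => [|n IH] S f; rewrite ?leqn0.
  rewrite cards_eq0 => /eqP SC _ f0 pf; exists f => //.
  by rewrite -(setCK S) SC setC0 in pf.
move=> Sn h0S f0 pf.
have [SC|[x0]] := set_0Vmem (~: S).
  by exists f => //; move: pf; rewrite -(setCK S) SC setC0.
rewrite inE => x0S; have [x [f' [xS pf' ff']]] := partial_iso_step pf x0S.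
apply: (IH _ f' _ _ _ pf'); last by rewrite ff'.
  rewrite -ltnS (leq_trans _ Sn) //; apply: proper_card; rewrite setCU.
  apply/properP; split; first exact: subsetIr.
  by exists x; rewrite !inE ?eqxx.
by rewrite !inE h0S orbT.
Qed.

End Extension.

(** * Forests failing Schmidt's criterion *)

Section CutAndSwap.
Variable G : sgraph.

(** The new automorphism is [t] on [B], the inverse of [t] on [t @: B] when the two sets are
    disjoint, and the identity elsewhere. Edges leaving [B] end at fixed points of [t], so
    adjacencies across the border survive. *)
Lemma cut_automorphism (t : {perm G}) (B : {set G}) :
  t \in graph_aut G ->
  (forall x y, x \in B -> y \notin B -> adj x y -> t y = y) ->
  t @: B = B \/ [disjoint B & t @: B] ->
  exists2 s : {perm G}, s \in graph_aut G &
    {in B, s =1 t} /\ supp s \subset B :|: t @: B.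
Proof.
move=> /graph_autP tA out dich.
have tBE z : (z \in t @: B) = ((t^-1)%g z \in B).
  by rewrite -{1}(permKV t z) mem_imset //; exact: perm_inj.
pose f z := if z \in B then t z else if z \in t @: B then (t^-1)%g z else z.
have fB z : z \in B -> f z = t z by rewrite /f => ->.
have fN z : z \notin B -> z \notin t @: B -> f z = z.
  by rewrite /f => /negbTE-> /negbTE->.
have BtB z : z \in B -> t z \in t @: B by move=> zB; apply: imset_f.
have out_adj x y : x \in B -> y \notin B -> y \notin t @: B ->
    adj (t x) y = adj x y.
  move=> xB yB ytB; rewrite -{1}(permKV t y) tA; set y' := (t^-1)%g y.
  have y'B : y' \notin B by rewrite -tBE.
  have ty' : t y' = y by rewrite permKV.
  apply/idP/idP => xy.
    by have := out _ _ xB y'B xy; rewrite ty' => {1}->.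
  have /perm_inj <- // : t y = t y' by rewrite ty' (out _ _ xB yB xy).
have [finj fadj] : injective f /\ forall x y, adj (f x) (f y) = adj x y.
  case: dich => [tB|dis].
    rewrite tB in fN out_adj.
    have fBB z : z \in B -> f z \in B by move=> zB; rewrite fB // -tB BtB.
    split=> x y; have [xB|xB] := boolP (x \in B); have [yB|yB] := boolP (y \in B).
    - by rewrite !fB // => /perm_inj.
    - by move=> E; have := fBB _ xB; rewrite E fN // (negbTE yB).
    - by move=> E; have := fBB _ yB; rewrite -E fN // (negbTE xB).
    - by rewrite !fN.
    - by rewrite !fB.
    - by rewrite fB // fN // out_adj.
    - by rewrite adj_sym [RHS]adj_sym fB // fN // out_adj.
    - by rewrite !fN.
  have tBN z : z \in t @: B -> z \notin B.
    by move=> ztB; apply/negP => zB; have := disjointFr dis zB; rewrite ztB.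
  have ft z : z \in B -> f (t z) = z.
    by move=> zB; rewrite /f (negbTE (tBN _ (BtB _ zB))) BtB // permK.
  have caseP z : [\/ z \in B, exists2 w, w \in B & z = t w
      | z \notin B /\ z \notin t @: B].
    have [zB|zB] := boolP (z \in B); first by constructor 1.
    have [/imsetP[w wB ->]|ztB] := boolP (z \in t @: B); last by constructor 3.
    by constructor 2; exists w.
  (* Such an edge would leave [B], so [t] would fix [t y], and [t y = y] would lie in [B]. *)
  have no_adj x y : x \in B -> y \in B -> adj x (t y) = false.
    move=> xB yB; apply/negP => xy.
    have := out _ _ xB (tBN _ (BtB _ yB)) xy => /perm_inj tyy.
    by have := tBN _ (BtB _ yB); rewrite tyy yB.
  split; first apply: (can_inj (g := f)) => z; last move=> x y.
    have [zB|[w wB ->]|[zB ztB]] := caseP z.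
    - by rewrite (fB z) // ft.
    - by rewrite ft // fB.
    - by rewrite !fN.
  have [xB|[x' x'B ->]|[xB xtB]] := caseP x;
    have [yB|[y' y'B ->]|[yB ytB]] := caseP y.
  - by rewrite !fB.
  - by rewrite fB // ft // no_adj // adj_sym no_adj.
  - by rewrite fB // fN // out_adj.
  - by rewrite ft // fB // no_adj // adj_sym no_adj.
  - by rewrite !ft // tA.
  - by rewrite ft // fN // out_adj.
  - by rewrite fN // fB // adj_sym out_adj // adj_sym.
  - by rewrite fN // ft // adj_sym -out_adj // adj_sym.
  - by rewrite !fN.
exists (perm finj); first by apply/graph_autP => x y; rewrite !permE.
split=> [z zB|]; first by rewrite permE fB.
apply/subsetP => z; rewrite !inE permE; apply: contraR.
by rewrite negb_or => /andP[zB ztB]; rewrite fN.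
Qed.

End CutAndSwap.

(** * The centre of a coloured tree, by removal of leaves *)

Section Centre.
Variable G : sgraph.
Hypothesis acG : acyclic G.

Definition connected_in (S : {set G}) :=
  {in S &, forall x y, connect (induced_adj S) x y}.

Definition deg_in (S : {set G}) x := #|[set y in S | adj x y]|.

Lemma connected_in_comp (S : {set G}) : connected_in S -> comp_connected S.
Proof. by move=> cS x y xS yS _; apply: cS. Qed.

(** Used for leaf removal: inner vertices of a simple path have degree at least 2, so a path between
    surviving vertices survives. *)
Lemma path_inner (e : rel G) x p : symmetric e -> path e x p -> uniq (x :: p) ->
  forall z, z \in p -> z = last x p \/ exists u v, [/\ u != v, e z u & e z v].
Proof.
move=> esym; elim: p x => [|y p IH] x //= /andP[xy yp] /andP[xyp yp_uniq] z.
rewrite inE => /predU1P[->|zp]; last exact: IH.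
case: p yp xyp {IH yp_uniq} => [|w p] /=; first by left.
move=> /andP[yw _]; rewrite !inE !negb_or => /and3P[_ xw _].
by right; exists x, w; split=> //; rewrite esym.
Qed.

(** A connected proper subset of maximal size containing [x0] misses exactly one vertex, and by
    [unique_neighbour] this vertex has only one neighbour in it. *)
Lemma exists_leaf (S : {set G}) : connected_in S -> 1 < #|S| ->
  exists2 x, x \in S & deg_in S x <= 1.
Proof.
move=> cS S2.
have [x0 x0S] : exists x, x \in S by apply/card_gt0P; apply: ltnW.
pose P (X : {set G}) := [&& X \proper S, x0 \in X &
  [forall x in X, forall y in X, connect (induced_adj X) x y]].
have P0 : P [set x0].
  rewrite /P set11 properEcard sub1set x0S cards1 S2 /=.
  by apply/forall_inP => x /set1P->; apply/forall_inP => y /set1P->; apply: connect0.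
case: (@arg_maxnP _ [set x0] P (fun X => #|X|) P0) => X /and3P[XS x0X cX] Xmax.
have {}cX : connected_in X.
  by move=> x y xX yX; move/forall_inP: cX => /(_ _ xX)/forall_inP/(_ _ yX).
have [XsubS [y yS yX]] := properP XS.
have [u [v [uX vS vX uv]]] : exists u v, [/\ u \in X, v \in S, v \notin X & adj u v].
  apply: contrapT => no.
  have clX : closed (induced_adj S) X.
    apply: intro_closed => [|a b /and3P[aS bS ab] aX]; first exact: induced_connect_sym.
    by apply/negPn/negP => bX; apply: no; exists a, b.
  by move: x0X; rewrite (closed_connect clX (cS _ _ x0S yS)) (negbTE yX).
have uX' : connected_in (v |: X).
  have cc := comp_connected_nbr (connected_in_comp cX) uX uv.
  move=> a b aV bV; apply: cc => //.
  have to_u w : w \in v |: X -> connect (@adj G) u w.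
    rewrite !inE => /predU1P[->|wX]; first exact: connect1.
    by apply: (@induced_connect_adj _ X); apply: cX.
  by apply: (@connect_trans _ _ u); rewrite ?to_u // adj_connect_sym to_u.
have vXS : v |: X = S.
  apply/eqP; apply: contraT => ne.
  have : P (v |: X).
    rewrite /P !inE x0X orbT /= properEneq ne subUset sub1set vS XsubS /=.
    by apply/forall_inP => a aV; apply/forall_inP => b bV; apply: uX'.
  by move/Xmax; rewrite cardsU1 vX /= add1n ltnn.
exists v => //; rewrite /deg_in leqNgt; apply/negP => /card_gt1P[a [b [aP bP]]].
move=> /eqP; apply.
have inX w : w \in [set z in S | adj v z] -> w \in X /\ adj w v.
  rewrite inE -{1}vXS !inE => /andP[/predU1P[->|wX] vw]; first by rewrite adj_irr in vw.
  by rewrite adj_sym vw.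
have [aX av] := inX _ aP; have [bX bv] := inX _ bP.
exact: (unique_neighbour acG (connected_in_comp cX) aX bX vX av bv).
Qed.

Variables (T : eqType) (c : G -> T).
Hypothesis colour_trans : forall x y, c x = c y ->
  exists2 s : {perm G}, s \in graph_aut G & (forall z, c (s z) = c z) /\ s x = y.

Definition colour_closed (S : {set G}) :=
  forall x y, x \in S -> c x = c y -> y \in S.

(** A colour-preserving automorphism taking [x] to [y] maps [S] onto itself. *)
Lemma deg_in_colour (S : {set G}) x y : colour_closed S -> c x = c y ->
  deg_in S x = deg_in S y.
Proof.
move=> clS /colour_trans[s /graph_autP sA [sc <-]].
rewrite /deg_in -(card_imset _ (@perm_inj _ s)); apply: eq_card => z.
have sS w : (s w \in S) = (w \in S).
  by apply/idP/idP => wS; apply: clS wS _; rewrite sc.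
by rewrite -(permKV s z) mem_imset ?inE ?sS ?sA //; exact: perm_inj.
Qed.

(* Removing all leaves of [S] keeps it connected and colour-closed. *)
Lemma colour_centre (S : {set G}) : connected_in S -> colour_closed S -> S != set0 ->
  exists S' : {set G}, [/\ S' \subset S, connected_in S', colour_closed S', S' != set0 &
    #|S'| <= 2].
Proof.
have [n] := ubnP #|S|; elim: n S => // n IH S Sn cS clS S0.
have [S2|S2] := leqP #|S| 2; first by exists S.
pose S' := [set x in S | 1 < deg_in S x].
have S'S : S' \subset S by apply/subsetP => x; rewrite inE => /andP[].
have cS' : connected_in S'.
  move=> x y xS' yS'.
  have xS := subsetP S'S _ xS'; have yS := subsetP S'S _ yS'.
  have /connectP[p0 pp0 lastp0] := cS _ _ xS yS.
  case/shortenP: pp0 lastp0 => p pp un _ lastp.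
  have inS' : {in x :: p, forall z, z \in S'}.
    move=> z; rewrite inE => /predU1P[->//|zp].
    have [zE|[u [v [uv zu zv]]]] := path_inner (induced_adj_sym S) pp un zp.
      by rewrite zE -lastp.
    have [zS uS au] := and3P zu; have [_ vS av] := and3P zv.
    by rewrite inE zS; apply/card_gt1P; exists u, v; rewrite !inE uS vS.
  apply/connectP; exists p => //.
  elim: p (x) pp inS' {un lastp} => //= z p IHp w /andP[wz zp] inS'.
  rewrite {1}/induced_adj !inS' ?inE ?eqxx ?orbT //=.
  have [_ _ ->] := and3P wz; apply: IHp => // a ap.
  by apply: inS'; rewrite inE ap orbT.
have clS' : colour_closed S'.
  move=> x y; rewrite !inE => /andP[xS dx] cxy.
  by rewrite (clS _ _ xS cxy) -(deg_in_colour clS cxy).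
(* If every vertex were a leaf, [x] and its neighbours would form a closed set, hence all of [S],
   with at most two elements. *)
have S'0 : S' != set0.
  have [x xS] := set0Pn _ S0.
  apply/negP => /eqP S'0.
  have deg1 z : z \in S -> deg_in S z <= 1.
    move=> zS; rewrite leqNgt; apply/negP => dz.
    by have := in_set0 z; rewrite -S'0 inE zS dz.
  have clo : closed (induced_adj S) (x |: [set y in S | adj x y]).
    apply: intro_closed; first exact: induced_connect_sym.
    move=> a b /and3P[aS bS ab]; rewrite !inE => /predU1P[aE|/andP[_ xa]].
      by rewrite bS -aE ab orbT.
    apply/orP; left; apply/negPn/negP => bx.
    have := deg1 _ aS; rewrite leqNgt => /negP; apply; apply/card_gt1P.
    by exists b, x; rewrite !inE bS xS ab adj_sym xa.
  have : S \subset x |: [set y in S | adj x y].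
    apply/subsetP => y yS.
    by rewrite -(closed_connect clo (cS _ _ xS yS)) !inE eqxx.
  move/subset_leq_card; rewrite cardsU1 !inE adj_irr andbF /= add1n.
  by move=> /(leq_trans S2); rewrite ltnS ltnNge deg1.
have [x xS dx] := exists_leaf cS (ltnW S2).
have [|S'' [S''S' ? ? ? ?]] := IH S' _ cS' clS' S'0; last first.
  by exists S''; split=> //; apply: subset_trans S''S' S'S.
rewrite -ltnS (leq_trans _ Sn) // ltnS; apply/proper_card/properP; split=> //.
by exists x; rewrite // inE xS -leqNgt.
Qed.

End Centre.

(** * Moving vertices, links and rigidity *)

Section Rigidity.
Variables (G : sgraph) (T : eqType) (c : G -> T).

Definition moving := [set x | [exists y, (y != x) && (c y == c x)]].

Definition moving_adj := induced_adj moving.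

(* Leaving out edges within a colour class cuts a central edge whose ends are
   exchanged by an automorphism. *)
Definition link : rel G := fun x y => moving_adj x y && (c x != c y).

Lemma link_connect_sym : connect_sym link.
Proof.
apply: sym_connect_sym => x y.
by rewrite /link /moving_adj induced_adj_sym eq_sym.
Qed.

(** Together: each [link]-component of moving vertices meets every nontrivial class exactly once, so
    there are as many components as vertices in such a class, hence at most three. *)
Record rigid : Prop := Rigid {
  link_inj : forall x y, connect link x y -> c x = c y -> x = y;
  class_le3 : forall x, #|[set y | c y == c x]| <= 3;
  link_classes : {in moving &, forall x y,
    exists2 z, connect link x z & c z = c y}
}.

Lemma movingP x : reflect (exists2 y, y != x & c y = c x) (x \in moving).
Proof.
rewrite inE; apply: (iffP existsP) => [[y /andP[yx /eqP cy]]|[y yx cy]].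
  by exists y.
by exists y; rewrite yx cy eqxx.
Qed.

Lemma moving_colour x y : c x = c y -> (x \in moving) = (y \in moving).
Proof.
suff sub u v : c u = c v -> u \in moving -> v \in moving.
  by move=> cxy; apply/idP/idP; apply: sub.
move=> cuv /movingP[w wu cw]; apply/movingP.
have [vE|wv] := eqVneq w v; last by exists w; rewrite // cw.
by exists u; rewrite // -vE eq_sym.
Qed.

Hypothesis acG : acyclic G.
Hypothesis colour_trans : forall x y, c x = c y ->
  exists2 s : {perm G}, s \in graph_aut G & (forall z, c (s z) = c z) /\ s x = y.

Local Notation caut s := (s \in graph_aut G /\ forall z, c (s z) = c z).
Local Notation kappa := (connect moving_adj).
Local Notation comp x := [set y | kappa x y].

Let ksym : symmetric kappa.
Proof. exact: induced_connect_sym. Qed.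

Lemma caut_fixed (s : {perm G}) x : caut s -> x \notin moving -> s x = x.
Proof.
move=> [_ sc]; apply: contraNeq => sx; apply/movingP.
by exists (s x).
Qed.

Lemma cautV (s : {perm G}) : caut s -> caut (s^-1)%g.
Proof.
move=> [sA sc]; split; first by rewrite groupV.
by move=> z; rewrite -{2}(permKV s z) sc.
Qed.

Lemma caut_moving (s : {perm G}) x : caut s -> (s x \in moving) = (x \in moving).
Proof. by move=> [_ sc]; apply: moving_colour. Qed.

Lemma caut_connect (s : {perm G}) x y : caut s -> kappa (s x) (s y) = kappa x y.
Proof.
suff mono (t : {perm G}) u v : caut t -> kappa u v -> kappa (t u) (t v).
  move=> sC; apply/idP/idP; last exact: mono.
  by move/(mono _ _ _ (cautV sC)); rewrite !permK.
move=> tC; have [/graph_autP tA _] := tC.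
move=> /connectP[p pp ->]; elim: p u pp => [|w p IH] u /=; first by rewrite connect0.
move=> /andP[/and3P[uM wM uw] /IH]; apply: connect_trans; apply: connect1.
by rewrite /moving_adj /induced_adj !caut_moving // uM wM tA.
Qed.

Lemma caut_comp (s : {perm G}) x : caut s -> s @: comp x = comp (s x).
Proof.
move=> sC; apply/setP => y; rewrite -(permKV s y) mem_imset; last exact: perm_inj.
by rewrite !inE caut_connect.
Qed.

(** Cut an automorphism taking [x] to [y] along the moving component of [x]: edges leaving it end at
    vertices that are not moving, hence fixed. *)
Lemma local_automorphism x y : x != y -> c x = c y ->
  exists2 s : {perm G}, s \in graph_aut G &
    s != 1%g /\ supp s \subset comp x :|: comp y.
Proof.
move=> xy cxy; have [t tA [tc tx]] := colour_trans cxy.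
have tC : caut t by [].
have xM : x \in moving by apply/movingP; exists y; rewrite // eq_sym.
have [||s sA [sB ssupp]] := @cut_automorphism _ t (comp x) tA.
- move=> b z; rewrite !inE => xb xz bz; apply: (caut_fixed tC); apply: contra xz => zM.
  apply: (connect_trans xb); apply: connect1.
  by rewrite /moving_adj /induced_adj zM bz (induced_connect_in xb xM).
- rewrite caut_comp // tx; have [kxy|kxy] := boolP (kappa x y); [left|right].
    by apply/setP => z; rewrite !inE (same_connect ksym kxy).
  apply/pred0P => z; rewrite !inE /=; apply/negP => /andP[xz yz].
  by move: kxy; rewrite (connect_trans xz) // ksym.
exists s => //; split; last by rewrite -tx -caut_comp.
apply/eqP => s1; move: xy; rewrite -tx -sB ?inE //.
by rewrite s1 perm1 eqxx.
Qed.

Lemma disjoint_pairs_schmidt x y z w : x != y -> c x = c y -> z != w -> c z = c w ->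
  ~~ kappa x z -> ~~ kappa x w -> ~~ kappa y z -> ~~ kappa y w ->
  schmidt_criterion G.
Proof.
move=> xy cxy zw czw xz xw yz yw.
have [s sA [s1 ss]] := local_automorphism xy cxy.
have [t tA [t1 ts]] := local_automorphism zw czw.
exists s, t; split=> //.
apply: disjointWl ss _; apply: disjointWr ts _.
apply/pred0P => v; rewrite !inE /=; apply/negP.
move=> /andP[/orP[] av /orP[] bv].
- by move: xz; rewrite (connect_trans av) // ksym.
- by move: xw; rewrite (connect_trans av) // ksym.
- by move: yz; rewrite (connect_trans av) // ksym.
- by move: yw; rewrite (connect_trans av) // ksym.
Qed.

(** Here [link] is all of [moving_adj]. Four vertices of one class would lie in four components and
    split into two pairs with disjoint local automorphisms; so would two pairs from classes that
    share no component. *)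
Lemma rigid_discrete : ~ schmidt_criterion G ->
  (forall x y, kappa x y -> c x = c y -> x = y) -> rigid.
Proof.
move=> nS disc.
have linkE : link =2 moving_adj.
  move=> x y; rewrite /link; case xy: (moving_adj x y) => //=.
  apply/eqP => cxy; have [_ _] := and3P xy.
  by rewrite (disc _ _ (connect1 xy) cxy) adj_irr.
have connE := eq_connect linkE.
split=> [x y|x|x y xM yM].
- by rewrite connE; apply: disc.
- rewrite leqNgt; apply/negP => /card_geqP[[|y1 [|y2 [|y3 [|y4 [|? ?]]]]] [un //= _ sub]].
  have col y : y \in [:: y1; y2; y3; y4] -> c y = c x.
    by move=> /sub; rewrite inE => /eqP.
  have nk u v : u \in [:: y1; y2; y3; y4] -> v \in [:: y1; y2; y3; y4] ->
      u != v -> ~~ kappa u v.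
    by move=> uS vS; apply: contra => /disc ->; rewrite ?col.
  move: un; rewrite /= !inE !negb_or => /and4P[/and3P[n12 n13 n14] /andP[n23 n24] n34 _].
  apply: nS; apply: (@disjoint_pairs_schmidt y1 y2 y3 y4) => //;
    by first [apply: etrans (col _ _) (esym (col _ _))|apply: nk]; rewrite ?inE ?eqxx ?orbT.
- have [x' x'x cx'] := movingP _ xM; have [y' y'y cy'] := movingP _ yM.
  have [p [q [cp cq pq]]] : exists p q, [/\ c p = c x, c q = c y & kappa p q].
    apply: contrapT => no; apply: nS.
    apply: (@disjoint_pairs_schmidt x' x y' y) => //; apply/negP => kk; apply: no.
    + by exists x', y'.
    + by exists x', y.
    + by exists x, y'.
    + by exists x, y.
  have [t tA [tc <-]] := colour_trans cp.
  by exists (t q); rewrite ?connE ?caut_connect // tc.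
Qed.

Section CentralEdge.
Variables a b : G.
Hypotheses (ab : adj a b) (class_ab : forall x, c x = c a -> x = a \/ x = b).
Hypotheses (cab : c b = c a) (all_conn : {in moving, forall x, kappa a x}).

(** Without the central edge the moving vertices fall into the halves of [a] and of [b]. *)
Let e : rel G := fun x y => moving_adj x y &&
  ~~ [|| (x == a) && (y == b) | (x == b) && (y == a)].
Let half x := [set y | connect e x y].

Let aM : a \in moving.
Proof. by apply/movingP; exists b => //; apply: contraTneq ab => ->; rewrite adj_irr. Qed.

Let bM : b \in moving. Proof. by rewrite (moving_colour cab). Qed.

Let a_neq_b : a != b.
Proof. by apply: contraTneq ab => ->; rewrite adj_irr. Qed.

Let e_sym : connect_sym e.
Proof.
apply: sym_connect_sym => x y; rewrite /e /moving_adj induced_adj_sym.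
by rewrite orbC [(x == b) && _]andbC [(x == a) && _]andbC.
Qed.

Let nab : ~~ connect e a b.
Proof.
apply: acyclic_edge => //; first by move=> x y /andP[/and3P[]].
by rewrite /e !eqxx andbF.
Qed.

Let cover x : x \in moving -> connect e a x || connect e b x.
Proof.
move=> /all_conn ax.
rewrite -[_ || _]/(x \in [pred x | connect e a x || connect e b x]).
rewrite -(closed_connect _ ax) ?inE ?connect0 //.
apply: intro_closed; first exact: ksym.
move=> u v uv; rewrite !inE.
have [uvE|nuv] := boolP (e u v).
  by case/orP=> w; rewrite (connect_trans w (connect1 uvE)) ?orbT.
move: nuv; rewrite /e uv /= negbK.
by case/orP=> /andP[/eqP-> /eqP->] _; rewrite connect0 ?orbT.
Qed.

(** The ends [a] and [b] form a whole class, so colour-preserving automorphisms preserve the central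
    edge. *)
Let caut_e (s : {perm G}) x y : caut s -> connect e x y -> connect e (s x) (s y).
Proof.
move=> sC; have [/graph_autP sA sc] := sC.
have sab z : (s z == a) || (s z == b) = (z == a) || (z == b).
  suff sub (t : {perm G}) u : caut t -> (u == a) || (u == b) -> (t u == a) || (t u == b).
    apply/idP/idP; last exact: sub.
    by move=> H; have := sub _ _ (cautV sC) H; rewrite permK.
  move=> [_ tc] uab; have /class_ab : c (t u) = c a.
    by rewrite tc; case/orP: uab => /eqP->.
  by case=> ->; rewrite eqxx ?orbT.
move=> /connectP[p pp ->]; elim: p x pp => [|w p IH] x /=; first by rewrite connect0.
move=> /andP[/andP[/and3P[xM wM xw] nxw] /IH]; apply: connect_trans; apply: connect1.
rewrite /e /moving_adj /induced_adj !caut_moving // xM wM sA xw /=.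
apply: contra nxw => sxw.
have wx : x != w by apply: contraTneq xw => ->; rewrite adj_irr.
have xab : (x == a) || (x == b).
  by rewrite -sab; case/orP: sxw => /andP[-> _]; rewrite ?orbT.
have wab : (w == a) || (w == b).
  by rewrite -sab; case/orP: sxw => /andP[_ ->]; rewrite ?orbT.
move: wx; case/orP: xab => /eqP->; case/orP: wab => /eqP->; by rewrite !eqxx ?orbT.
Qed.

Let caut_half (s : {perm G}) x : caut s -> s @: half x = half (s x).
Proof.
move=> sC; apply/setP => y; rewrite -(permKV s y) mem_imset; last exact: perm_inj.
rewrite !inE; apply/idP/idP; first exact: caut_e.
by move=> /(caut_e (cautV sC)); rewrite !permK.
Qed.

(** An automorphism taking [x] to [y] cannot exchange the halves, so it fixes [u] and [v]. It can
    then be cut along [half u], since the only moving edge leaving this half ends at [v]. *)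
Let half_local u v x y : (u = a /\ v = b) \/ (u = b /\ v = a) ->
  x != y -> c x = c y -> x \in half u -> y \in half u ->
  exists2 s : {perm G}, s \in graph_aut G & s != 1%g /\ supp s \subset half u.
Proof.
move=> uv xy cxy; rewrite !inE => ux uy; have [t tA [tc tx]] := colour_trans cxy.
have tC : caut t by [].
have nuv : ~~ connect e u v by case: uv => -[-> ->] //; rewrite e_sym.
have uM : u \in moving by case: uv => -[-> _].
have cl z : c z = c u -> z = u \/ z = v.
  case: uv => -[-> ->]; first exact: class_ab.
  by rewrite cab => /class_ab[]; [right|left].
have cuv : c v = c u by case: uv => -[-> ->].
have tu : t u = u.
  have [//|tuv] := cl (t u) (tc u).
  by move: nuv; rewrite -tuv (connect_trans uy) // e_sym -tx caut_e.
have tv : t v = v.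
  have [|//] := cl (t v) (etrans (tc v) cuv).
  rewrite -{1}tu => /perm_inj vu; by move: nuv; rewrite vu connect0.
have tB : t @: half u = half u by rewrite caut_half // tu.
have [|s sA [sB ssupp]] := @cut_automorphism _ t (half u) tA _ (or_introl tB).
  move=> p z; rewrite !inE => up uz pz.
  have [zM|] := boolP (z \in moving); last exact: caut_fixed.
  have pM : p \in moving.
    rewrite -(@closed_connect _ e (mem moving) _ u p) //.
    by move=> ? ? /andP[/and3P[-> ->]].
  have /negPn : ~~ ~~ [|| (p == a) && (z == b) | (p == b) && (z == a)].
    apply: contra uz => H; apply: connect_trans up _; apply: connect1.
    by rewrite /e /moving_adj /induced_adj pM zM pz.
  by case: uv tu tv => -[-> ->] tu tv /orP[]/andP[_ /eqP->].
exists s => //; split; last by rewrite tB setUid in ssupp.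
apply/eqP => s1; move: xy; rewrite -tx -sB ?inE //.
by rewrite s1 perm1 eqxx.
Qed.

(** Two vertices of one colour in the half of [a], and their images in the half of [b] under an
    automorphism exchanging the ends, would give two automorphisms with disjoint supports. So each
    half meets a class at most once, and [link] agrees with [e]. *)
Lemma rigid_central_edge : ~ schmidt_criterion G -> rigid.
Proof.
move=> nS.
have dis : [disjoint half a & half b].
  apply/pred0P => z; rewrite !inE /=; apply/negP => /andP[az bz].
  by move: nab; rewrite (connect_trans az) // e_sym.
have [r rA [rc ra]] := colour_trans (esym cab).
have rC : caut r by [].
have rb : r b = a.
  have [//|rb] := class_ab (etrans (rc b) cab).
  have /perm_inj abE : r a = r b by rewrite ra rb.
  by move: a_neq_b; rewrite abE eqxx.
have disc_a x y : c x = c y -> x \in half a -> y \in half a -> x = y.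
  move=> cxy xa ya; apply/eqP/negPn/negP => xy; apply: nS.
  have [|s sA [s1 ss]] := @half_local a b x y _ xy cxy xa ya; first by left.
  have [|||||t tA [t1 ts]] := @half_local b a (r x) (r y) _ _ _ _ _.
  - by right.
  - by rewrite (inj_eq perm_inj).
  - by rewrite !rc.
  - by rewrite -ra -caut_half // imset_f.
  - by rewrite -ra -caut_half // imset_f.
  exists s, t; split=> //.
  by apply: disjointWl ss _; apply: disjointWr ts _.
have disc_b x y : c x = c y -> x \in half b -> y \in half b -> x = y.
  move=> cxy xb yb; apply: (@perm_inj _ r); apply: disc_a; first by rewrite !rc.
  - by rewrite -rb -caut_half // imset_f.
  - by rewrite -rb -caut_half // imset_f.
have halves x : x \in moving -> x \in half a \/ x \in half b.
  by move=> /cover/orP[]; rewrite !inE; [left|right].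
have disc u x y : connect e u x -> connect e u y -> u \in moving -> c x = c y -> x = y.
  move=> ux uy /halves[]; rewrite inE => hu cxy.
    by apply: disc_a; rewrite // inE; apply: connect_trans hu _.
  by apply: disc_b; rewrite // inE; apply: connect_trans hu _.
have linkE : link =2 e.
  move=> x y; rewrite /link /e; case xy: (moving_adj x y) => //=.
  have [/orP[]/andP[/eqP-> /eqP->]|nxy] := boolP (_ || _).
  - by rewrite cab eqxx.
  - by rewrite cab eqxx.
  apply/eqP => cxy; have [xM _ xy'] := and3P xy.
  have exy : e x y by rewrite /e xy.
  by move: xy'; rewrite (disc x x y (connect0 _ _) (connect1 exy) xM cxy) adj_irr.
have connE := eq_connect linkE.
split=> [x y|x|x y xM yM].
- rewrite connE => xy cxy.
  have [xM|xM] := boolP (x \in moving); first exact: disc xM cxy.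
  by apply/eqP/negPn/negP => nxy; move/movingP: xM; apply; exists y; rewrite // eq_sym.
- have [xM|xM] := boolP (x \in moving); last first.
    rewrite (_ : [set y | _] = [set x]) ?cards1 //; apply/setP => y; rewrite !inE.
    apply/eqP/eqP => [cy|-> //]; apply/eqP/negPn/negP => yx; move/movingP: xM; apply.
    by exists y.
  apply: (@leq_trans 2) => //.
  rewrite -(cardsID (half a)) -[2]/(1 + 1) leq_add //.
    apply/card_le1_eqP => u v; rewrite !inE => /andP[/eqP cu ua] /andP[/eqP cv va].
    by apply: disc_a; rewrite ?inE // cu.
  apply/card_le1_eqP => u v; rewrite !inE => /andP[ua /eqP cu] /andP[va /eqP cv].
  have uM : u \in moving by rewrite (moving_colour cu).
  have vM : v \in moving by rewrite (moving_colour cv).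
  apply: disc_b; first by rewrite cu.
    by case: (halves _ vM); rewrite !inE ?(negbTE va).
  by case: (halves _ uM); rewrite !inE ?(negbTE ua).
- have [y' y'y cy'] := movingP _ yM.
  have y'M : y' \in moving by rewrite (moving_colour cy').
  have join u z : x \in half u -> z \in half u -> connect link x z.
    by rewrite !inE connE => ux uz; apply: connect_trans uz; rewrite e_sym.
  (* The classmates [y] and [y'] lie in different halves, so one of them shares the half of [x]. *)
  case: (halves _ xM) => xh; case: (halves _ yM) => yh; case: (halves _ y'M) => y'h.
  all: first [by exists y => //; apply: join xh yh
             |by exists y' => //; apply: join xh y'h|exfalso].
  + by move: y'y; rewrite (disc_b _ _ cy' y'h yh) eqxx.
  + by move: y'y; rewrite (disc_a _ _ cy' y'h yh) eqxx.
Qed.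

End CentralEdge.

(** If two vertices of one colour share a moving component, this component is all of [moving], and
    its centre is a class of two adjacent vertices. *)
Theorem not_schmidt_rigid : ~ schmidt_criterion G -> rigid.
Proof.
move=> nS.
have [disc|] := pselect (forall x y, kappa x y -> c x = c y -> x = y).
  exact: rigid_discrete.
move=> /existsNP[x /existsNP[y /not_implyP[kxy /not_implyP[cxy /eqP xy]]]].
have xM : x \in moving by apply/movingP; exists y; rewrite // eq_sym.
(* For [z] outside the component of [x], a second pair disjoint from [x], [y] is either [z] with its
   classmate [z'] or, if [z'] is in the component, the image of the pair [x], [y] under an
   automorphism taking [z'] to [z]. *)
have conn_x z : z \in moving -> kappa x z.
  move=> zM; apply/negPn/negP => xz; apply: nS.
  have [z' z'z cz'] := movingP _ zM.
  have [xz'|xz'] := boolP (kappa x z').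
    have [t tA [tc tz']] := colour_trans cz'.
    have tC : caut t by [].
    have zt u : kappa x u -> kappa z (t u).
      move=> xu; rewrite -tz' caut_connect //; apply: connect_trans xu.
      by rewrite ksym.
    have nxt u : kappa x u -> ~~ kappa x (t u).
      by move=> /zt zu; apply: contra xz => xu; apply: (connect_trans xu); rewrite ksym.
    have nyt u : kappa x u -> ~~ kappa y (t u).
      by move=> xu; rewrite -(same_connect ksym kxy); apply: nxt.
    apply: (@disjoint_pairs_schmidt x y (t x) (t y)); rewrite ?nxt ?nyt ?tc //.
    by rewrite (inj_eq perm_inj).
  apply: (@disjoint_pairs_schmidt x y z' z) => //.
    by rewrite -(same_connect ksym kxy).
  by rewrite -(same_connect ksym kxy).
have [|||S [SM cS clS S0 S2]] := @colour_centre G acG T c colour_trans moving.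
- by move=> u v uM vM; apply: connect_trans (conn_x _ vM); rewrite ksym conn_x.
- by move=> u v uM /moving_colour <-.
- by apply/set0Pn; exists x.
have [a aS] := set0Pn _ S0.
(* The centre is closed under colours, so it contains a classmate of [a]; having at most two
   elements, it is this pair. *)
have [b ba cba] := movingP _ (subsetP SM _ aS).
have bS : b \in S by apply: clS aS _.
have SE : S = [set a; b].
  apply/esym/eqP; rewrite eqEcard subUset !sub1set aS bS cards2 /= (leq_trans S2) //.
  by rewrite eq_sym ba.
apply: (@rigid_central_edge a b) => //.
- have /connectP[[|z p] /= pp bE] := cS _ _ aS bS; first by rewrite bE eqxx in ba.
  have [_ zS az] := and3P (proj1 (andP pp)).
  move: zS az; rewrite SE !inE => /orP[]/eqP-> //.
  by rewrite adj_irr.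
- move=> z cz; have : z \in S by apply: clS aS _.
  by rewrite SE !inE => /orP[]/eqP; [left|right].
- by move=> z zM; apply: connect_trans (conn_x _ zM); rewrite ksym conn_x // (subsetP SM).
Qed.

End Rigidity.

(** * Magic unitaries between forests *)

Local Open Scope ring_scope.
Local Open Scope complex_scope.

Lemma alg_nat_inj (R : realType) (A : algType R[i]) (m n : nat) :
  m%:R = n%:R :> A -> m = n.
Proof.
rewrite -(scaler_nat m (1 : A)) -(scaler_nat n (1 : A)) => /eqP.
rewrite -subr_eq0 -scalerBl scaler_eq0 oner_eq0 orbF.
by rewrite subr_eq0 eqr_nat => /eqP.
Qed.

Section Equitable.
Variables (R : realType) (A : starAlgType R) (H G : sgraph) (U : H -> G -> A).
Hypotheses (magicU : magic_unitary U) (interU : intertwines U).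
(** An abstract form of positivity: in a C*-algebra it comes from the norm, in the *-algebra [OQu]
    from the orthogonality relations. *)
Hypothesis row_pos : forall h (n : G -> nat), \sum_g U h g *+ n g = 0 ->
  forall g, (0 < n g)%N -> U h g = 0.
Hypothesis col_pos : forall g (n : H -> nat), \sum_h U h g *+ n h = 0 ->
  forall h, (0 < n h)%N -> U h g = 0.

(** The bipartite graph of nonzero entries. Roots of its components name the classes, so that rows
    and columns share one type of colours. *)
Definition entry_rel : rel (H + G) := fun x y =>
  match x, y with
  | inl h, inr g => U h g != 0
  | inr g, inl h => U h g != 0
  | _, _ => false
  end.

Definition row_class (h : H) : (H + G)%type := fingraph.root entry_rel (inl h).
Definition col_class (g : G) : (H + G)%type := fingraph.root entry_rel (inr g).

Lemma entry_sym : connect_sym entry_rel.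
Proof. by apply: sym_connect_sym => -[h|g] [h'|g']. Qed.

Lemma entry_class h g : U h g != 0 -> row_class h = col_class g.
Proof. by move=> Uhg; apply/(fingraph.rootP entry_sym)/connect1. Qed.

Lemma row_class_sum h k :
  \sum_(g | col_class g == k) U h g = (row_class h == k)%:R.
Proof.
have [_ rows _] := magicU.
have [<-|hk] := eqVneq (row_class h) k.
  rewrite -(rows h) [RHS](bigID (fun g => col_class g == row_class h)) /=.
  rewrite [X in _ = _ + X]big1 ?addr0 // => g; apply: contraNeq.
  by move/entry_class->.
rewrite big1 // => g /eqP gk; apply/eqP; apply: contraNT hk.
by move/entry_class->; rewrite gk.
Qed.

Lemma col_class_sum g k :
  \sum_(h | row_class h == k) U h g = (col_class g == k)%:R.
Proof.
have [_ _ cols] := magicU.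
have [<-|gk] := eqVneq (col_class g) k.
  rewrite -(cols g) [RHS](bigID (fun h => row_class h == col_class g)) /=.
  rewrite [X in _ = _ + X]big1 ?addr0 // => h; apply: contraNeq.
  by move/entry_class->.
rewrite big1 // => h /eqP hk; apply/eqP; apply: contraNT gk.
by move/entry_class<-; rewrite hk.
Qed.

(** Both cardinals count the sum of [U h g] over the block of class [k], once by rows and once by
    columns. *)
Lemma class_card k :
  #|[set h | row_class h == k]| = #|[set g | col_class g == k]|.
Proof.
apply: (@alg_nat_inj _ A); rewrite !cardsE -!sum1_card !natr_sum.
transitivity (\sum_(h | row_class h == k) \sum_(g | col_class g == k) U h g).
  by apply: eq_bigr => h /eqP hk; rewrite row_class_sum hk eqxx.
by rewrite exchange_big /=; apply: eq_bigr => g /eqP gk; rewrite col_class_sum gk eqxx.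
Qed.

Definition row_deg k h := #|[set x | adj h x & row_class x == k]|.
Definition col_deg k g := #|[set y | adj g y & col_class y == k]|.

(** The intertwining relation at [h], summed over the columns of class [k], makes the degree of [h]
    an average of column degrees weighted by row [h]. *)
Lemma row_deg_sum h k : \sum_g U h g *+ col_deg k g = (row_deg k h)%:R.
Proof.
transitivity (\sum_(g | col_class g == k) \sum_g' U h g' * (adj g' g)%:R).
  rewrite exchange_big /=; apply: eq_bigr => g' _.
  rewrite -mulr_sumr -mulr_natr; congr (_ * _).
  rewrite /col_deg cardsE -sum1_card natr_sum.
  rewrite (eq_bigl (fun g => (col_class g == k) && adj g' g)); last first.
    by move=> g; rewrite /= andbC.
  by rewrite big_mkcondr /=; apply: eq_bigr => g _; case: adj.
transitivity (\sum_(g | col_class g == k) \sum_h' (adj h h')%:R * U h' g).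
  by apply: eq_bigr => g _; apply: interU.
rewrite exchange_big /=.
transitivity (\sum_h' (adj h h')%:R * (row_class h' == k)%:R : A).
  by apply: eq_bigr => h' _; rewrite -mulr_sumr row_class_sum.
rewrite /row_deg cardsE -sum1_card natr_sum [RHS]big_mkcond /=.
by apply: eq_bigr => h' _; rewrite -natrM mulnb unfold_in; case: (_ && _).
Qed.

Lemma col_deg_sum g k : \sum_h U h g *+ row_deg k h = (col_deg k g)%:R.
Proof.
transitivity (\sum_(h | row_class h == k) \sum_h' (adj h h')%:R * U h' g).
  rewrite exchange_big /=; apply: eq_bigr => h' _.
  rewrite -mulr_suml -mulr_natl; congr (_ * _).
  rewrite /row_deg cardsE -sum1_card natr_sum.
  rewrite (eq_bigl (fun h => (row_class h == k) && adj h h')); last first.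
    by move=> h; rewrite /= andbC adj_sym.
  by rewrite big_mkcondr /=; apply: eq_bigr => h _; case: adj.
transitivity (\sum_(h | row_class h == k) \sum_g' U h g' * (adj g' g)%:R).
  by apply: eq_bigr => h _; rewrite interU.
rewrite exchange_big /=.
transitivity (\sum_g' (col_class g' == k)%:R * (adj g' g)%:R : A).
  by apply: eq_bigr => g' _; rewrite -mulr_suml col_class_sum.
rewrite /col_deg cardsE -sum1_card natr_sum [RHS]big_mkcond /=.
by apply: eq_bigr => g' _; rewrite -natrM mulnb andbC adj_sym unfold_in; case: (_ && _).
Qed.

(* At a vertex of maximal degree the degree is an average of the degrees of the
   matched vertices, hence equal to each of them. *)
Lemma class_deg h g k : row_class h = col_class g -> row_deg k h = col_deg k g.
Proof.
move=> /(fingraph.rootP entry_sym) hg.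
have [_ rows cols] := magicU.
pose d (z : H + G) := match z with inl x => row_deg k x | inr y => col_deg k y end.
have [m hm mmax] : exists2 m, connect entry_rel (inl h) m &
    forall z, connect entry_rel (inl h) z -> (d z <= d m)%N.
  by case: (@arg_maxnP _ (inl h) (connect entry_rel (inl h)) d (connect0 _ _)) => m; exists m.
pose a : pred (H + G) := [pred z | connect entry_rel (inl h) z && (d z == d m)].
have cl : closed entry_rel a.
  apply: intro_closed; first exact: entry_sym.
  move=> x y xy /andP[hx /eqP dx].
  have hy : connect entry_rel (inl h) y := connect_trans hx (connect1 xy).
  rewrite inE hy /= eqn_leq mmax // -subn_eq0; apply: contraT; rewrite -lt0n.
  move: x y xy hx dx hy => [x|x] [y|y] //= Uxy hx dx hy lt.
    have max_nbr z : U x z != 0 -> (col_deg k z <= d m)%N.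
      move=> Uxz; apply: (mmax (inr z)); apply: connect_trans hx _; exact: connect1.
    (* Truncated subtraction is harmless: [col_deg k z] can exceed [d m] only where [U x z]
       vanishes. *)
    have := @row_pos x (fun z => d m - col_deg k z)%N _ y lt.
    move=> H0; case/eqP: Uxy; apply: H0.
    transitivity (\sum_z (U x z *+ d m - U x z *+ col_deg k z)).
      apply: eq_bigr => z _; have [->|Uz] := eqVneq (U x z) 0; first by rewrite !mul0rn subr0.
      by rewrite mulrnBr // max_nbr.
    by rewrite sumrB row_deg_sum sumrMnl rows dx subrr.
  have max_nbr z : U z x != 0 -> (row_deg k z <= d m)%N.
    move=> Uzx; apply: (mmax (inl z)); apply: connect_trans hx _; exact: connect1.
  have := @col_pos x (fun z => d m - row_deg k z)%N _ y lt.
  move=> H0; case/eqP: Uxy; apply: H0.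
  transitivity (\sum_z (U z x *+ d m - U z x *+ row_deg k z)).
    apply: eq_bigr => z _; have [->|Uz] := eqVneq (U z x) 0; first by rewrite !mul0rn subr0.
    by rewrite mulrnBr // max_nbr.
  by rewrite sumrB col_deg_sum sumrMnl cols dx subrr.
have ma : m \in a by rewrite inE hm /=.
have := ma; rewrite -(closed_connect cl hm) => /andP[_ /eqP dh].
move: ma; rewrite -(closed_connect cl hm) (closed_connect cl hg) => /andP[_ /eqP dg].
by rewrite -[row_deg k h]/(d (inl h)) dh -dg.
Qed.

Lemma magic_forest_iso h0 g0 : is_forest H -> is_forest G -> row_class h0 = col_class g0 ->
  exists f : H -> G, [/\ bijective f, forall x y, adj (f x) (f y) = adj x y,
    forall x, col_class (f x) = row_class x & f h0 = g0].
Proof.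
move=> fH fG; apply: coloured_forest_iso.
- exact: forest_acyclic.
- exact: forest_acyclic.
- by move=> h g k /class_deg; apply.
- exact: class_card.
Qed.

End Equitable.

Lemma projection_compl (R : realType) (A : starAlgType R) (p : A) :
  is_projection p -> is_projection (1 - p).
Proof.
move=> [sp pp]; split; first by rewrite starB star1 sp.
by rewrite mulrBl mul1r mulrBr mulr1 pp subrr subr0.
Qed.

(** * Vanishing sums of projections in a C*-algebra *)

Section CStarPositivity.
Variables (R : realType) (B : cstarAlgType R).
Implicit Types p : B.

Lemma cnorm_proj_le1 p : is_projection p -> cnorm p <= 1.
Proof.
move=> [sp pp]; have := cnorm_starM p; rewrite sp pp => E.
have [->|p0] := eqVneq (cnorm p) 0; first exact: ler01.
suff -> : cnorm p = 1 by [].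
by apply: (mulfI p0); rewrite mulr1 -expr2.
Qed.

Lemma cnorm_natl (n : nat) (x : B) : cnorm (x *+ n) = n%:R * cnorm x.
Proof.
rewrite -scaler_nat cnormZ; congr (_ * _).
by rewrite -(rmorph_nat (real_complex R)) /= expr0n /= addr0 sqrtr_sqr ger0_norm.
Qed.

(* If [\sum_i n_i p_i = 0], then [N + n_j p_j], with [N := \sum_i n_i], is
   [n_j + \sum_(i != j) n_i (1 - p_i)], of norm at most [N]; but it multiplies
   [p_j] by [N + n_j]. *)
Lemma projections_sum0 (I : finType) (p : I -> B) (n : I -> nat) :
  (forall i, is_projection (p i)) -> \sum_i p i *+ n i = 0 ->
  forall i, (0 < n i)%N -> p i = 0.
Proof.
move=> proj sum0 j nj.
pose N := (\sum_i n i)%N.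
have NE : 1 *+ N + p j *+ n j = 1 *+ n j + \sum_(i | i != j) (1 - p i) *+ n i.
  rewrite /N (bigD1 j) //= mulrnDr -sumrMnr -addrA; congr (_ + _).
  have -> : p j *+ n j = - (\sum_(i | i != j) p i *+ n i).
    by apply/eqP; rewrite -addr_eq0; move/eqP: sum0; rewrite (bigD1 j).
  by rewrite -sumrB; apply: eq_bigr => i _; rewrite mulrnBl.
have le_sum (J : seq I) (P : pred I) (F : I -> B) :
    cnorm (\sum_(i <- J | P i) F i) <= \sum_(i <- J | P i) cnorm (F i).
  elim/big_rec2: _ => [|i y x _ xy]; first by rewrite -(scale0r (1 : B)) cnormZ normc0 mul0r.
  by rewrite (le_trans (cnormD _ _)) // lerD2l.
have leN : cnorm (1 *+ N + p j *+ n j) <= N%:R.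
  rewrite NE (le_trans (cnormD _ _)) // cnorm_natl cnorm1 mulr1.
  rewrite /N [in leRHS](bigD1 j) //= natrD lerD2l natr_sum (le_trans (le_sum _ _ _)) //.
  apply: ler_sum => i _; rewrite cnorm_natl -[leRHS]mulr1 ler_wpM2l //.
  exact/cnorm_proj_le1/projection_compl.
apply: cnorm_eq0; apply/eqP; rewrite eq_le cnorm_ge0 andbT.
have [_ pp] := proj j.
have : cnorm ((1 *+ N + p j *+ n j) * p j) <= N%:R * cnorm (p j).
  by rewrite (le_trans (cnormM _ _)) // ler_wpM2r // cnorm_ge0.
rewrite mulrDl (mulrnAl (1 : B)) (mulrnAl (p j)) mul1r pp -mulrnDr cnorm_natl natrD mulrDl gerDl.
by rewrite pmulr_rle0 // ltr0n.
Qed.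

End CStarPositivity.

(** Positivity comes from [projections_sum0]. The greedy isomorphism goes from [H] to [G], so its
    inverse is the answer. *)
Lemma quantum_isomorphic_forests (R : realType) (G H : sgraph) :
  is_forest G -> is_forest H -> quantum_isomorphic R G H -> isomorphic G H.
Proof.
move=> fG fH [_ [X [U [magicU interU]]]].
have [proj _ _] := magicU.
have row_pos h (n : G -> nat) : \sum_g U h g *+ n g = 0 ->
    forall g, (0 < n g)%N -> U h g = 0.
  by apply: projections_sum0 => g; apply: proj.
have col_pos g (n : H -> nat) : \sum_h U h g *+ n h = 0 ->
    forall h, (0 < n h)%N -> U h g = 0.
  by move=> s0 h nh; apply: (@projections_sum0 _ _ _ (U ^~ g) n).
have /card_gt0P[h0 _] := vertex_gt0 H.
have [g0 /eqP g0P] : exists g, col_class U g == row_class U h0.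
  have : (0 < #|[set g | col_class U g == row_class U h0]|)%N.
    by rewrite -class_card //; apply/card_gt0P; exists h0; rewrite inE.
  by move=> /card_gt0P[g]; rewrite inE; exists g.
have [f [[g fK gK] fadj _ _]] := magic_forest_iso magicU interU row_pos col_pos fH fG (esym g0P).
exists g; first by exists f.
by move=> x y; rewrite -{2}(gK x) -{2}(gK y) fadj.
Qed.

(** * The C*-norm of a matrix *)

Section RealInnerProduct.
Variables (R : realType) (m : nat).
Local Notation C := R[i].
Implicit Types v w : 'cV[C]_m.

(** The real part of the Hermitian product gives the same norm and the same adjoints, and keeps all
    inequalities in [R]. *)
Definition hdot v w : R := \sum_i complex.Re ((v i 0)^*%C * w i 0).

Definition vnorm v : R := Num.sqrt (hdot v v).

Lemma hdotC v w : hdot v w = hdot w v.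
Proof.
apply: eq_bigr => i _; case: (v i 0) (w i 0) => [a b] [c d] /=.
by ring.
Qed.

Lemma hdotDr v w1 w2 : hdot v (w1 + w2) = hdot v w1 + hdot v w2.
Proof.
rewrite -big_split; apply: eq_bigr => i _; rewrite mxE.
by case: (v i 0) (w1 i 0) (w2 i 0) => [a b] [c d] [e f] /=; ring.
Qed.

Lemma hdotZr v (r : R) w : hdot v (r%:C *: w) = r * hdot v w.
Proof.
rewrite mulr_sumr; apply: eq_bigr => i _; rewrite mxE.
by case: (v i 0) (w i 0) => [a b] [c d] /=; ring.
Qed.

Lemma hdotDl v1 v2 w : hdot (v1 + v2) w = hdot v1 w + hdot v2 w.
Proof. by rewrite hdotC hdotDr !(hdotC w). Qed.

Lemma hdotZl (r : R) v w : hdot (r%:C *: v) w = r * hdot v w.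
Proof. by rewrite hdotC hdotZr hdotC. Qed.

Lemma hdot_sqr v : hdot v v = \sum_i normc (v i 0) ^+ 2.
Proof.
apply: eq_bigr => i _; case: (v i 0) => [a b].
by rewrite /normc sqr_sqrtr ?addr_ge0 ?sqr_ge0 //=; ring.
Qed.

Lemma hdot_ge0 v : 0 <= hdot v v.
Proof. by rewrite hdot_sqr sumr_ge0 // => i _; apply: sqr_ge0. Qed.

Lemma hdot_eq0 v : hdot v v = 0 -> v = 0.
Proof.
rewrite hdot_sqr => /eqP; rewrite psumr_eq0 => [/allP v0|i _]; last exact: sqr_ge0.
apply/matrixP => i j; rewrite (ord1 j) mxE; apply: eq0_normc.
by apply/eqP; rewrite -sqrf_eq0; apply: v0; rewrite mem_index_enum.
Qed.

Lemma vnorm_ge0 v : 0 <= vnorm v. Proof. exact: sqrtr_ge0. Qed.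

Lemma vnorm_sqr v : vnorm v ^+ 2 = hdot v v.
Proof. by rewrite sqr_sqrtr // hdot_ge0. Qed.

Lemma vnorm_eq0 v : vnorm v = 0 -> v = 0.
Proof. by move=> v0; apply: hdot_eq0; rewrite -vnorm_sqr v0 expr0n. Qed.

Lemma vnorm0 : vnorm 0 = 0.
Proof.
rewrite /vnorm hdot_sqr big1 ?sqrtr0 // => i _.
by rewrite mxE normc0 expr0n.
Qed.

Lemma cauchy_schwarz v w : hdot v w <= vnorm v * vnorm w.
Proof.
suff : hdot v w ^+ 2 <= hdot v v * hdot w w.
  rewrite -!vnorm_sqr -exprMn => le.
  rewrite (le_trans (ler_norm _)) // -ler_sqr ?nnegrE ?mulr_ge0 ?vnorm_ge0 //.
  by rewrite real_normK // num_real.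
have [w0|w0] := eqVneq (hdot w w) 0.
  rewrite w0 mulr0 (hdot_eq0 w0) -(scale0r 0) -[0]/(0%:C) hdotZr mul0r.
  by rewrite expr0n.
have wgt0 : 0 < hdot w w by rewrite lt_neqAle eq_sym w0 hdot_ge0.
(* The component of [v] orthogonal to [w], scaled by [hdot w w] to avoid a division. *)
have := hdot_ge0 ((hdot w w)%:C *: v + (- hdot v w)%:C *: w).
rewrite !hdotDr !hdotDl !hdotZr !hdotZl (hdotC w v) => le.
rewrite -(ler_pM2l wgt0) -subr_ge0; apply: le_trans le _.
by rewrite le_eqVlt; apply/orP; left; apply/eqP; ring.
Qed.

Lemma vnormD v w : vnorm (v + w) <= vnorm v + vnorm w.
Proof.
rewrite -ler_sqr ?nnegrE ?addr_ge0 ?vnorm_ge0 // sqrrD !vnorm_sqr.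
rewrite hdotDr !hdotDl (hdotC w v).
have := cauchy_schwarz v w; lra.
Qed.

Lemma vnormZ (c : C) v : vnorm (c *: v) = normc c * vnorm v.
Proof.
rewrite /vnorm !hdot_sqr.
rewrite -[normc c]ger0_norm ?normc_ge0 // -sqrtr_sqr -sqrtrM ?sqr_ge0 //.
congr (Num.sqrt _); rewrite mulr_sumr; apply: eq_bigr => i _.
by rewrite mxE normcM exprMn.
Qed.

End RealInnerProduct.

Section MatrixStarAlgebra.
Variables (R : realType) (n : nat).
Local Notation C := R[i].

(** A positive size keeps the algebra nonzero; the separate name carries the star structure. *)
Definition cmatrix : Type := 'M[C]_n.+1.

HB.instance Definition _ := GRing.Algebra.on cmatrix.

Definition adjoint (A : cmatrix) : cmatrix := (map_mx (@conjc R) A)^T.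

Lemma adjointK A : adjoint (adjoint A) = A.
Proof. by apply/matrixP => i j; rewrite !mxE conjcK. Qed.

Lemma adjointD A B : adjoint (A + B) = adjoint A + adjoint B.
Proof. by apply/matrixP => i j; rewrite !mxE rmorphD. Qed.

Lemma adjointZ (c : C) A : adjoint (c *: A) = c^*%C *: adjoint A.
Proof. by apply/matrixP => i j; rewrite !mxE rmorphM. Qed.

Lemma adjointM A B : adjoint (A * B) = adjoint B * adjoint A.
Proof. by rewrite /adjoint -!mulmxE map_mxM trmx_mul. Qed.

HB.instance Definition _ := Algebra_isStarAlgebra.Build R cmatrix
  adjointK adjointD adjointZ adjointM.

Implicit Types (A B : cmatrix) (v w : 'cV[C]_n.+1).

Lemma hdot_adjoint A v w : hdot (A *m v) w = hdot v (adjoint A *m w).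
Proof.
rewrite /hdot.
have ReE (I : finType) (F : I -> C) : \sum_i complex.Re (F i) = complex.Re (\sum_i F i).
  by rewrite raddf_sum.
rewrite !ReE; congr complex.Re.
transitivity (\sum_i \sum_j (v j 0)^*%C * ((A i j)^*%C * w i 0)).
  apply: eq_bigr => i _; rewrite mxE rmorph_sum mulr_suml; apply: eq_bigr => j _.
  by rewrite rmorphM /= mulrCA mulrA.
rewrite exchange_big; apply: eq_bigr => j _.
by rewrite [in RHS]mxE mulr_sumr; apply: eq_bigr => i _; rewrite !mxE.
Qed.

Definition opnorm A : R := sup [set vnorm (A *m v) | v in [set v | vnorm v <= 1]]%classic.

Lemma opnorm_has_sup A :
  has_sup [set vnorm (A *m v) | v in [set v | vnorm v <= 1]]%classic.
Proof.
split; first by exists (vnorm (A *m 0)), 0; rewrite //= vnorm0.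
(* Coordinates of a vector in the unit ball have modulus at most 1, so row sums of moduli bound the
   coordinates of its image. *)
pose M := \sum_i (\sum_j normc (A i j)) ^+ 2.
exists (Num.sqrt M) => _ [v /= v1 <-]; rewrite ler_wsqrtr // hdot_sqr.
apply: ler_sum => i _; rewrite ler_sqr ?nnegrE ?normc_ge0 ?sumr_ge0 //; last first.
  by move=> j _; apply: normc_ge0.
have vj j : normc (v j 0) <= 1.
  rewrite -(@ler_sqr _ (normc _)) ?nnegrE ?normc_ge0 // expr1n.
  have : hdot v v <= 1 by rewrite -vnorm_sqr expr_le1 // vnorm_ge0.
  apply: le_trans; rewrite hdot_sqr (bigD1 j) //= lerDl.
  by apply: sumr_ge0 => k _; apply: sqr_ge0.
rewrite mxE; elim/big_rec2: _ => [|j y x _ xy]; first by rewrite normc0.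
have normc_add (a b : C) : normc (a + b) <= normc a + normc b.
  by have := ler_normD a b; rewrite -lecR rmorphD.
rewrite (le_trans (normc_add _ _)) // lerD // normcM.
by rewrite ler_piMr ?normc_ge0.
Qed.

Lemma opnorm_le A (r : R) : (forall v, vnorm v <= 1 -> vnorm (A *m v) <= r) ->
  opnorm A <= r.
Proof.
move=> H; apply: ge_sup; first by have [] := opnorm_has_sup A.
by move=> _ [v /= v1 <-]; apply: H.
Qed.

Lemma opnorm_ub A v : vnorm (A *m v) <= opnorm A * vnorm v.
Proof.
have [v0|v0] := eqVneq (vnorm v) 0.
  by rewrite v0 (vnorm_eq0 v0) mulmx0 vnorm0 mulr0.
have vgt0 : 0 < vnorm v by rewrite lt_neqAle eq_sym v0 vnorm_ge0.
have nr (r : R) : 0 <= r -> normc r%:C = r.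
  by move=> r0; rewrite /normc /= expr0n /= addr0 sqrtr_sqr ger0_norm.
rewrite -ler_pdivrMr // mulrC -{1}(nr (vnorm v)^-1) ?invr_ge0 ?vnorm_ge0 //.
rewrite -vnormZ scalemxAr; apply: (sup_upper_bound (opnorm_has_sup A)).
exists ((vnorm v)^-1%:C *: v) => //=.
by rewrite vnormZ nr ?invr_ge0 ?vnorm_ge0 // mulVf.
Qed.

Lemma opnorm_ge0 A : 0 <= opnorm A.
Proof.
apply: le_trans (vnorm_ge0 (A *m 0)) _; apply: (sup_upper_bound (opnorm_has_sup A)).
by exists 0; rewrite //= vnorm0.
Qed.

Lemma opnorm_eq0 A : opnorm A = 0 -> A = 0.
Proof.
move=> A0; apply/matrixP => i j.
have : A *m delta_mx j 0 = 0 :> 'cV_n.+1.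
  apply: vnorm_eq0; apply/le_anti; rewrite vnorm_ge0 andbT.
  by rewrite -(mul0r (vnorm (delta_mx j 0))) -A0 opnorm_ub.
by rewrite -colE => /matrixP/(_ i 0); rewrite !mxE.
Qed.

Lemma opnormD A B : opnorm (A + B) <= opnorm A + opnorm B.
Proof.
apply: opnorm_le => v v1; rewrite mulmxDl (le_trans (vnormD _ _)) //.
by rewrite lerD // (le_trans (opnorm_ub _ _)) // ler_piMr // opnorm_ge0.
Qed.

Lemma opnormM A B : opnorm (A * B) <= opnorm A * opnorm B.
Proof.
apply: opnorm_le => v v1; rewrite -mulmxE -mulmxA (le_trans (opnorm_ub _ _)) //.
by rewrite ler_wpM2l ?opnorm_ge0 // (le_trans (opnorm_ub _ _)) // ler_piMr // opnorm_ge0.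
Qed.

Lemma opnormZ (c : C) A : opnorm (c *: A) = normc c * opnorm A.
Proof.
have le d B : opnorm (d *: B) <= normc d * opnorm B.
  apply: opnorm_le => v v1; rewrite -scalemxAl vnormZ ler_wpM2l ?normc_ge0 //.
  by rewrite (le_trans (opnorm_ub _ _)) // ler_piMr // opnorm_ge0.
apply/le_anti; rewrite le /=.
have [->|c0] := eqVneq c 0; first by rewrite normc0 mul0r opnorm_ge0.
have nc : 0 < normc c.
  rewrite lt_neqAle normc_ge0 andbT eq_sym.
  by apply: contra c0 => /eqP/eq0_normc ->.
rewrite mulrC -ler_pdivlMr // mulrC -normcV.
by rewrite (le_trans _ (le _ _)) // scalerA mulVf // scale1r.
Qed.

(** For [w := adjoint A *m v] with [vnorm v <= 1], Cauchy-Schwarz gives [vnorm w ^+ 2 = hdot v (A *m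
    w) <= opnorm A * vnorm w]. *)
Lemma opnorm_adjoint_le A : opnorm (adjoint A) <= opnorm A.
Proof.
apply: opnorm_le => v v1; set w := _ *m v.
have [w0|w0] := eqVneq (vnorm w) 0; first by rewrite w0 opnorm_ge0.
have wgt0 : 0 < vnorm w by rewrite lt_neqAle eq_sym w0 vnorm_ge0.
rewrite -(ler_pM2r wgt0) -expr2 vnorm_sqr {1}/w hdot_adjoint adjointK.
rewrite (le_trans (cauchy_schwarz _ _)) // (le_trans (ler_wpM2r (vnorm_ge0 _) v1)) //.
by rewrite mul1r opnorm_ub.
Qed.

Lemma opnorm_starM A : opnorm (star A * A) = opnorm A ^+ 2.
Proof.
apply/le_anti/andP; split.
  by rewrite (le_trans (opnormM _ _)) // expr2 ler_wpM2r ?opnorm_ge0 ?opnorm_adjoint_le.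
rewrite -[leRHS]sqr_sqrtr ?opnorm_ge0 // ler_sqr ?nnegrE ?sqrtr_ge0 ?opnorm_ge0 //.
apply: opnorm_le => v v1; rewrite ler_wsqrtr // hdot_adjoint mulmxA.
rewrite (le_trans (cauchy_schwarz _ _)) // (le_trans (ler_wpM2r (vnorm_ge0 _) v1)) //.
by rewrite mul1r (le_trans (opnorm_ub _ _)) // ler_piMr // opnorm_ge0.
Qed.

Lemma opnorm1 : opnorm 1 = 1.
Proof.
have n0 : opnorm 1 != 0.
  by apply/eqP => /opnorm_eq0/eqP; rewrite oner_eq0.
apply: (mulfI n0); rewrite mulr1 -expr2 -opnorm_starM mulr1.
by rewrite star1.
Qed.

Definition opnorm_csn : cstarSeminorm cmatrix :=
  CStarSeminorm opnorm_ge0 opnormD opnormZ opnormM opnorm_starM opnorm1.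

End MatrixStarAlgebra.

(** * Two noncommuting projections *)

Section NoncommutingProjections.
Variable R : realType.
Local Notation M2 := (cmatrix R 1).

(** This matrix and the next are the orthogonal projections onto the lines of the first basis vector
    and of the all-ones vector. *)
Definition proj_e1 : M2 := \matrix_(i, j) ((i == 0) && (j == 0))%:R.
Definition proj_diag : M2 := const_mx 2^-1.

Lemma proj_e1P : is_projection proj_e1.
Proof.
split; apply/matrixP => i j; rewrite !mxE; first by rewrite rmorph_nat andbC.
rewrite 2!big_ord_recl big_ord0 !mxE /= andbF andbT mul0r !addr0.
by rewrite -natrM mulnb.
Qed.

Lemma proj_diagP : is_projection proj_diag.
Proof.
split; apply/matrixP => i j; rewrite !mxE.
  by rewrite fmorphV rmorph_nat.
rewrite 2!big_ord_recl big_ord0 !mxE addr0 -mulrDl.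
by field.
Qed.

Lemma proj_noncommuting : proj_e1 * proj_diag != proj_diag * proj_e1.
Proof.
apply/eqP => /matrixP/(_ 0 1); rewrite !mxE !big_ord_recl !big_ord0 !mxE /=.
rewrite mul0r !mulr0 !addr0 mul1r => /eqP.
by rewrite invr_eq0 pnatr_eq0.
Qed.

End NoncommutingProjections.

(** * The quantum automorphism group of a forest *)

Section Twist.
Variables (R : realType) (G : sgraph) (A : starAlgType R).
Variables (s : {perm G}) (r : G -> A).
Hypotheses (sA : s \in graph_aut G) (rproj : forall x, is_projection (r x)).
Hypotheses (rs : forall x, r (s x) = r x)
  (r_adj : forall x y, r x <> r y -> adj (s x) y = adj x y).

(** The matrix [r + (1 - r) s], where the projection [r x] may vary from one orbit of [s] to
    another. *)
Definition twist (x y : G) : A :=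
  (if x == y then r x else 0) + (if s x == y then 1 - r x else 0).

Let rN x : r x * (1 - r x) = 0.
Proof. by have [_ rr] := rproj x; rewrite mulrBr mulr1 rr subrr. Qed.

Let Nr x : (1 - r x) * r x = 0.
Proof. by have [_ rr] := rproj x; rewrite mulrBl mul1r rr subrr. Qed.

Lemma sum_if (x : G) (F : G -> A) : \sum_y (if x == y then F y else 0) = F x.
Proof. by rewrite -big_mkcond (big_pred1 x) // => y; rewrite eq_sym. Qed.

(** In the intertwining relation, row [x] and column [z] carry the weights [r x] and [r z]. If these
    agree, so do both sides; otherwise [r_adj] makes the two adjacencies equal, and the weights add
    up to 1. *)
Lemma twist_relations : qu_relations twist.
Proof.
have rsV x : r (s^-1%g x) = r x by rewrite -rs permKV.
have sV x y : (s x == y) = (s^-1%g y == x) by rewrite (can2_eq (permK s) (permKV s)) eq_sym.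
split; first split.
- move=> x y; rewrite /twist; have [sr rr] := rproj x.
  have [sN NN] := projection_compl (rproj x).
  case: eqP => _; case: eqP => _; rewrite ?addr0 ?add0r; split=> //.
  + by rewrite addrC subrK star1.
  + by rewrite addrC subrK mulr1.
  + by rewrite star0.
  + by rewrite mulr0.
- move=> x; rewrite big_split /=.
  by rewrite (sum_if x (fun=> r x)) (sum_if (s x) (fun=> 1 - r x)) addrC subrK.
- move=> y; rewrite big_split /=.
  under eq_bigr do rewrite eq_sym.
  under [X in _ + X]eq_bigr do rewrite sV.
  by rewrite (sum_if y r) (sum_if _ (fun x => 1 - r x)) rsV addrC subrK.
- move=> x y z /eqP yz; rewrite /twist; split.
    by case: eqP => ?; case: eqP => ?; case: eqP => ?; case: eqP => ?;
      rewrite ?addr0 ?add0r ?mulr0 ?mul0r ?rN ?Nr //; congruence.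
  case: (y =P x) => yx; case: (s y =P x) => syx; case: (z =P x) => zx; case: (s z =P x) => szx;
      rewrite ?addr0 ?add0r ?mulr0 ?mul0r //; try congruence.
  + by case: yz; apply: (@perm_inj _ s); congruence.
  + by case: yz; apply: (@perm_inj _ s); congruence.
  + by have <- : r y = r z by rewrite zx -syx rs.
  + by case: yz; apply: (@perm_inj _ s); congruence.
- move=> x z.
  transitivity (r x * (adj x z)%:R + (1 - r x) * (adj (s x) z)%:R).
    under eq_bigr do rewrite /twist mulrDl.
    rewrite big_split /=; congr (_ + _).
      rewrite -[RHS](sum_if x (fun y => r x * (adj y z)%:R)).
      by apply: eq_bigr => y _; case: eqP; rewrite ?mul0r.
    rewrite -[RHS](sum_if (s x) (fun y => (1 - r x) * (adj y z)%:R)).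
    by apply: eq_bigr => y _; case: eqP; rewrite ?mul0r.
  transitivity ((adj x z)%:R * r z + (adj (s x) z)%:R * (1 - r z)); last first.
    under [RHS]eq_bigr do rewrite /twist mulrDr.
    rewrite [RHS]big_split /=; congr (_ + _).
      rewrite -[LHS](sum_if z (fun y => (adj x y)%:R * r y)).
      by apply: eq_bigr => y _; rewrite eq_sym; case: eqP; rewrite ?mulr0.
    have /graph_autP sA' := sA.
    transitivity ((adj x (s^-1%g z))%:R * (1 - r (s^-1%g z))).
      by rewrite rsV -(sA' x) permKV.
    rewrite -[LHS](sum_if (s^-1%g z) (fun y => (adj x y)%:R * (1 - r y))).
    by apply: eq_bigr => y _; rewrite -sV; case: eqP; rewrite ?mulr0.
  have [->|/eqP ne] := eqVneq (r x) (r z); first by rewrite !mulr_natl !mulr_natr.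
  rewrite (r_adj ne) -mulrDl -mulrDr.
  by rewrite addrC subrK mul1r addrC subrK mulr1.
Qed.

End Twist.

Section QuAut.
Variables (R : realType) (G : sgraph).
Local Notation O := (OQu R G).
Local Notation u := (@OQu_gen R G).

Lemma OQu_ind (P : O -> Prop) :
  (forall x y, P (u x y)) -> P 1 ->
  (forall a b, P a -> P b -> P (a + b)) -> (forall a b, P a -> P b -> P (a * b)) ->
  (forall (c : R[i]) a, P a -> P (c *: a)) -> (forall a, P a -> P (star a)) ->
  forall a, P a.
Proof.
move=> Pg P1 PD PM PZ PS; elim/qpiW.
elim=> [x y|||t IHt|t IHt t' IHt'|t IHt t' IHt'|c t IHt|t IHt].
- exact: Pg.
- by rewrite (qpi0 (preOQu R G)) -(scale0r 1); apply: PZ.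
- by rewrite (qpi1 (preOQu R G)).
- by rewrite (qpiN (t : preOQu R G)) -scaleN1r; apply: PZ.
- by rewrite (qpiD (t : preOQu R G)); apply: PD.
- by rewrite (qpiM (t : preOQu R G)); apply: PM.
- by rewrite (qpiZ c (t : preOQu R G)); apply: PZ.
- by rewrite (qpi_star (t : preOQu R G)); apply: PS.
Qed.

(** The twist with [r = 0] is the permutation matrix of [s]; the homomorphism is evaluation at
    [s]. *)
Lemma permutation_hom (s : {perm G}) : s \in graph_aut G ->
  exists f : O -> O, is_star_hom f /\ forall x y, f (u x y) = (s x == y)%:R.
Proof.
move=> sA; have tw : qu_relations (twist s (fun=> 0 : O)).
  by apply: twist_relations => // x; split; [exact: star0|rewrite mulr0].
have [f [[fh fu] _]] := OQu_universal tw.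
exists f; split=> // x y; rewrite fu /twist subr0 if_same add0r.
by case: eqP.
Qed.

Lemma OQu_gen_neq0 x : u x x != 0.
Proof.
have [f [fh fu]] := permutation_hom (group1 (graph_aut_group G)).
apply/eqP => ux; have := fu x x; rewrite ux perm1 eqxx.
have -> : f 0 = 0 by rewrite -(scale0r (1 : O)) (star_homZ fh) (star_hom1 fh).
by move/eqP; rewrite eq_sym oner_eq0.
Qed.

(** On the scalar [u x x], evaluation at [s] agrees with evaluation at the identity, so
    [s x = x]. *)
Lemma trivial_Qu_asymmetric : trivial_Qu R G -> asymmetric G.
Proof.
move=> [e eK Ke]; apply/trivgP/subsetP => s sA; rewrite inE; apply/eqP/permP => x.
rewrite perm1.
have [f [fh fu]] := permutation_hom sA.
have [g [gh gu]] := permutation_hom (group1 (graph_aut_group G)).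
have := fu x x; have := gu x x.
rewrite perm1 eqxx -(Ke (u x x)) (star_homZ fh) (star_homZ gh) (star_hom1 fh) (star_hom1 gh).
by move=> ->; case: eqP => // _ /eqP; rewrite oner_eq0.
Qed.

Section Schmidt.
Variables s t : {perm G}.
Hypotheses (sA : s \in graph_aut G) (tA : t \in graph_aut G).
Hypothesis dis : [disjoint supp s & supp t].

Let notin_t x : x \in supp s -> t x = x.
Proof. by move=> /(disjointFr dis); rewrite inE => /negbFE/eqP. Qed.

Let notin_s x : x \notin supp s -> s x = x.
Proof. by rewrite inE negbK => /eqP. Qed.

Let supp_perm (p : {perm G}) x : (p x \in supp p) = (x \in supp p).
Proof. by rewrite !inE (inj_eq perm_inj). Qed.

Let st x : (s * t)%g x = if x \in supp s then s x else t x.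
Proof.
rewrite permM; case: ifP => xs; last by rewrite notin_s ?xs.
by rewrite notin_t // supp_perm.
Qed.

Variables (B : starAlgType R) (p q : B).
Hypotheses (pP : is_projection p) (qP : is_projection q).

(** Since the supports are disjoint, the product of the twists of [s] by [p] and of [t] by [q] is
    one twist of [s * t], by [p] on [supp s] and by [q] elsewhere. *)
Definition schmidt_entry : G -> G -> B :=
  twist (s * t)%g (fun x => if x \in supp s then p else q).

Lemma schmidt_entry_relations : qu_relations schmidt_entry.
Proof.
have st_supp x : ((s * t)%g x \in supp s) = (x \in supp s).
  rewrite st; case: ifP => xs; first by rewrite supp_perm.
  have [tx|tx] := boolP (x \in supp t); last by move: tx; rewrite inE negbK => /eqP->.
  by apply: (disjointFl dis); rewrite supp_perm.
apply: twist_relations.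
- exact: groupM.
- by move=> x; case: ifP.
- by move=> x; rewrite st_supp.
- have /graph_autP sA' := sA; have /graph_autP tA' := tA.
  move=> x y; rewrite st; case: ifPn => xs; case: ifPn => ys // _.
    by rewrite -{1}(notin_s ys) sA'.
  by rewrite -{1}(notin_t ys) tA'.
Qed.

Lemma schmidt_entry_s x : x \in supp s -> schmidt_entry x x = p.
Proof.
move=> xs; rewrite /schmidt_entry /twist st xs eqxx.
by move: xs; rewrite inE => /negbTE->; rewrite addr0.
Qed.

Lemma schmidt_entry_t x : x \in supp t -> schmidt_entry x x = q.
Proof.
move=> xt; have xs : (x \in supp s) = false := disjointFl dis xt.
rewrite /schmidt_entry /twist st xs eqxx.
by move: xt; rewrite inE => /negbTE->; rewrite addr0.
Qed.

End Schmidt.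

Definition pullback_csn (B : starAlgType R) (f : O -> B) (fh : is_star_hom f)
  (n : cstarSeminorm B) : cstarSeminorm O.
Proof.
refine (@CStarSeminorm R O (fun a => n (f a)) _ _ _ _ _ _).
- by move=> a; apply: csn_ge0.
- by move=> a b; rewrite (star_homD fh) csnD.
- by move=> c a; rewrite (star_homZ fh) csnZ.
- by move=> a b; rewrite (star_homM fh) csnM.
- by move=> a; rewrite (star_homM fh) (star_homS fh) csn_starM.
- by rewrite (star_hom1 fh) csn1.
Defined.

(** The universal norm dominates [n], and it vanishes on commutators when [CQu] is commutative. *)
Lemma CQu_commutative_csn (n : cstarSeminorm O) (a b : O) :
  (forall x y : CQu R G, x * y = y * x) -> n (a * b - b * a) = 0.
Proof.
move=> comm; apply/le_anti; rewrite csn_ge0 andbT.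
pose j := to_envelope (counit_csn R G) (@OQu_bounded R G).
have jh : is_star_hom j by exact: to_envelope_hom.
have j0 : j (a * b - b * a) = 0.
  by rewrite (star_homB _ _ jh) !(star_homM jh) comm subrr.
rewrite (le_trans (env_norm_ub (counit_csn R G) (@OQu_bounded R G) _ n)) //.
rewrite -[leLHS]/(env_csn (counit_csn R G) (@OQu_bounded R G) _) -to_completion_norm.
have -> : to_completion (env_csn (counit_csn R G) (@OQu_bounded R G)) (a * b - b * a) = 0.
  exact: j0.
have -> : 0 = to_completion (env_csn (counit_csn R G) (@OQu_bounded R G)) 0 by [].
by rewrite to_completion_norm csn0.
Qed.

Lemma schmidt_quantum_symmetry : schmidt_criterion G -> has_quantum_symmetry R G.
Proof.
move=> [s [t [sA tA s1 t1 dis]]] comm.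
have supp_ex (p : {perm G}) : p != 1%g -> exists x, x \in supp p.
  move=> p1; apply/set0Pn; apply: contraNneq p1 => p0; apply/eqP/permP => x.
  by rewrite perm1; have := in_set0 x; rewrite -p0 inE => /negbFE/eqP.
have [x xs] := supp_ex s s1; have [y yt] := supp_ex t t1.
have rel := schmidt_entry_relations sA tA dis (proj_e1P R) (proj_diagP R).
have [f [[fh fu] _]] := OQu_universal rel.
have := CQu_commutative_csn (pullback_csn fh (opnorm_csn R 1)) (u x x) (u y y) comm.
move=> /opnorm_eq0/eqP.
rewrite (star_homB _ _ fh) !(star_homM fh) !fu schmidt_entry_s // schmidt_entry_t //.
by rewrite subr_eq0 (negbTE (proj_noncommuting R)).
Qed.

Lemma OQu_commutative :
  (forall x y z w, u x y * u z w = u z w * u x y) -> forall a b : O, a * b = b * a.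
Proof.
move=> gen_comm.
have [[proj _ _] _ _] := OQu_relations R G.
have comm_gen (a : O) : forall x y, a * u x y = u x y * a.
  elim/OQu_ind: a => [x y z w|x y|a b IHa IHb x y|a b IHa IHb x y|c a IHa x y|a IHa x y].
  - exact: gen_comm.
  - by rewrite mul1r mulr1.
  - by rewrite mulrDl mulrDr IHa IHb.
  - by rewrite -mulrA IHb !mulrA IHa.
  - by rewrite -scalerAl -scalerAr IHa.
  - by have [<- _] := proj x y; rewrite -!starM IHa.
move=> a b; elim/OQu_ind: b a => [x y|| b b' IH IH'|b b' IH IH'|c b IH|b IH] a.
- exact: comm_gen.
- by rewrite mul1r mulr1.
- by rewrite mulrDl mulrDr IH IH'.
- by rewrite mulrA IH -mulrA IH' mulrA.
- by rewrite -scalerAl -scalerAr IH.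
- by rewrite -{1}(starK a) -starM -IH starM starK.
Qed.

Lemma CQu_commutative : (forall a b : O, a * b = b * a) -> ~ has_quantum_symmetry R G.
Proof.
move=> comm; apply; elim/qpiW => a; elim/qpiW => b.
rewrite -!qpiM; apply/qpi_eq/cs_eq_ext => n /=; exact: comm.
Qed.

(** Multiplication by [u x y] kills the other entries of the row. *)
Lemma OQu_row_pos x (n : G -> nat) : \sum_y u x y *+ n y = 0 ->
  forall y, (0 < n y)%N -> u x y = 0.
Proof.
have [[proj _ _] orth _] := OQu_relations R G.
move=> sum0 y ny; have [_ uu] := proj x y.
have : u x y * (\sum_z u x z *+ n z) = u x y *+ n y.
  rewrite mulr_sumr (bigD1 y) //= big1 ?addr0 => [|z zy]; first by rewrite mulrnAr uu.
  by rewrite mulrnAr (proj1 (orth x y z _)) ?mul0rn // eq_sym.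
rewrite sum0 mulr0 -scaler_nat => /esym/eqP; rewrite scaler_eq0 pnatr_eq0.
by rewrite eqn0Ngt ny => /eqP.
Qed.

Lemma OQu_col_pos y (n : G -> nat) : \sum_x u x y *+ n x = 0 ->
  forall x, (0 < n x)%N -> u x y = 0.
Proof.
have [[proj _ _] orth _] := OQu_relations R G.
move=> sum0 x nx; have [_ uu] := proj x y.
have : u x y * (\sum_z u z y *+ n z) = u x y *+ n x.
  rewrite mulr_sumr (bigD1 x) //= big1 ?addr0 => [|z zx]; first by rewrite mulrnAr uu.
  by rewrite mulrnAr (proj2 (orth y x z _)) ?mul0rn // eq_sym.
rewrite sum0 mulr0 -scaler_nat => /esym/eqP; rewrite scaler_eq0 pnatr_eq0.
by rewrite eqn0Ngt nx => /eqP.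
Qed.

Definition qclass (x : G) := row_class u x.

(** The nonzero diagonal entry joins row [x] to column [x], so one colouring of [G] serves both. *)
Lemma col_qclass x : col_class u x = qclass x.
Proof. by apply/esym/entry_class/OQu_gen_neq0. Qed.

Lemma qclass_entry x y : u x y != 0 -> qclass x = qclass y.
Proof. by move/entry_class; rewrite col_qclass. Qed.

Lemma qclass_entry0 x y : qclass x <> qclass y -> u x y = 0.
Proof. by move=> xy; apply/eqP/negPn/negP => /qclass_entry. Qed.

Lemma qclass_trans : is_forest G -> forall x y, qclass x = qclass y ->
  exists2 s : {perm G}, s \in graph_aut G & (forall z, qclass (s z) = qclass z) /\ s x = y.
Proof.
move=> fG x y xy; have [magicu _ interu] := OQu_relations R G.
have [|f [fbij fadj fc fx]] :=
  @magic_forest_iso _ _ _ _ _ magicu interu OQu_row_pos OQu_col_pos x y fG fG.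
  by rewrite col_qclass.
exists (perm (bij_inj fbij)); first by apply/graph_autP => a b; rewrite !permE.
by split=> [z|]; rewrite permE // -col_qclass.
Qed.

Lemma fixed_entry x y : x \notin moving qclass -> u x y = (x == y)%:R.
Proof.
move=> /movingP xM.
have x1 z : qclass z = qclass x -> z = x.
  by move=> zx; apply/eqP/negPn/negP => ne; apply: xM; exists z.
have off z : x != z -> u x z = 0.
  by move=> xz; apply: qclass_entry0 => /esym/x1 zx; rewrite zx eqxx in xz.
have [<-|/off //] := eqVneq x y.
have [[_ rows _] _ _] := OQu_relations R G.
rewrite -(rows x) (bigD1 x) //= big1 ?addr0 // => z zx.
by apply: off; rewrite eq_sym.
Qed.

Lemma asymmetric_trivial_Qu : is_forest G -> asymmetric G -> trivial_Qu R G.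
Proof.
move=> fG asym.
have class1 x y : qclass x = qclass y -> x = y.
  move=> /(qclass_trans fG)[s]; rewrite asym inE => /eqP-> [_ <-].
  by rewrite perm1.
have entry x y : u x y = (x == y)%:R.
  apply: fixed_entry; apply/movingP => -[z /eqP zx /class1]; exact: zx.
have scalar (a : O) : exists c : R[i], a = c *: 1.
  elim/OQu_ind: a => [x y||a b [c ->] [d ->]|a b [c ->] [d ->]|c a [d ->]|a [c ->]].
  - by exists (x == y)%:R; rewrite entry scaler_nat.
  - by exists 1; rewrite scale1r.
  - by exists (c + d); rewrite scalerDl.
  - by exists (c * d); rewrite -scalerAl mul1r scalerA.
  - by exists (c * d); rewrite scalerA.
  - by exists (c^*%C); rewrite starZ star1.
have /choice[e eE] := scalar.
exists e => // c; apply/eqP; rewrite -subr_eq0.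
have := eE (c *: 1) => /esym/eqP; rewrite -subr_eq0 -scalerBl scaler_eq0.
by rewrite oner_eq0 orbF.
Qed.

(** * Commuting entries in the rigid case *)

Section RigidForest.
Hypotheses (fG : is_forest G) (rig : rigid qclass).

(** In the intertwining relation between [x] and [y1], each side reduces to one term: by [link_inj],
    two vertices of one class linked to a common vertex coincide. *)
Lemma link_step x x1 y : link qclass x x1 -> qclass y = qclass x ->
  exists y1, [/\ qclass y1 = qclass x1, link qclass y y1 & u x y = u x1 y1].
Proof.
move=> xx1 yx; have [t tA [tc tx]] := qclass_trans fG (esym yx).
have /graph_autP tA' := tA.
have [/and3P[xM x1M adj1] ne] := andP xx1.
have link_of a b : qclass a = qclass x -> qclass b = qclass x1 -> adj a b -> link qclass a b.
  move=> ax bx ab.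
  by rewrite /link /moving_adj /induced_adj (moving_colour ax) (moving_colour bx) xM x1M ab ax bx.
exists (t x1); split; first exact: tc.
  by apply: link_of => //; rewrite ?tc // -tx tA'.
have [_ _ interu] := OQu_relations R G.
have := interu x (t x1).
rewrite (bigD1 y) //= big1 ?addr0 => [|z zy]; last first.
  have [->|/qclass_entry xz] := eqVneq (u x z) 0; first by rewrite mul0r.
  case ztx: (adj z (t x1)); last by rewrite mulr0.
  case/eqP: zy; apply: (link_inj rig); last by rewrite yx.
  apply: (@connect_trans _ _ (t x1)).
    by apply/connect1/link_of; rewrite ?tc.
  rewrite link_connect_sym; apply/connect1/link_of; rewrite ?tc //.
  by rewrite -tx tA'.
rewrite (bigD1 x1) //= big1 ?addr0 => [|z zx]; last first.
  have [->|/qclass_entry xz] := eqVneq (u z (t x1)) 0; first by rewrite mulr0.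
  rewrite tc in xz; case adjz: (adj x z); last by rewrite mul0r.
  case/eqP: zx; apply: (link_inj rig) => //.
  apply: (@connect_trans _ _ x); last exact: connect1.
  by rewrite link_connect_sym; apply/connect1/link_of.
by have -> : adj y (t x1) by [rewrite -tx tA']; rewrite adj1 mulr1 mul1r.
Qed.

Lemma link_transport x z y : connect (link qclass) x z -> qclass y = qclass x ->
  exists2 w, qclass w = qclass z & u x y = u z w.
Proof.
move=> /connectP[p pp ->]; elim: p x y pp => [|x1 p IH] x y /=; first by exists y.
move=> /andP[xx1 /IH{}IH] yx.
have [y1 [cy1 _ ->]] := link_step xx1 yx.
exact: IH.
Qed.

(** For [v] other than [w], replace [u z w] by 1 minus the rest of row [z]. The terms for 1 and for
    the columns [y] and [v] vanish by orthogonality, and any further column of the class would be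
    its fourth member. *)
Lemma class_orthogonal_mul x y z w v : qclass y = qclass x -> qclass z = qclass x ->
  qclass w = qclass x -> x != z -> y != w -> v != y -> u x y * u z w * u x v = 0.
Proof.
move=> cy cz cw xz yw vy.
have [[_ rows _] orth _] := OQu_relations R G.
have [cv|/eqP cv] := eqVneq (qclass x) (qclass v); last by rewrite (qclass_entry0 cv) mulr0.
have [->|vw] := eqVneq v w.
  by rewrite -mulrA (proj2 (orth _ _ _ _)) ?mulr0 // eq_sym.
have -> : u z w = 1 - \sum_(w' | w' != w) u z w'.
  by rewrite -(rows z) (bigD1 w) //= addrK.
rewrite mulrBr mulr1 mulrBl (proj1 (orth _ _ _ _)) 1?eq_sym // sub0r.
apply/eqP; rewrite oppr_eq0 mulr_sumr mulr_suml; apply/eqP/big1 => w' w'w.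
have [->|w'y] := eqVneq w' y; first by rewrite (proj2 (orth _ _ _ xz)) mul0r.
have [->|w'v] := eqVneq w' v; first by rewrite -mulrA (proj2 (orth _ _ _ _)) ?mulr0 // eq_sym.
have [cw'|/eqP cw'] := eqVneq (qclass z) (qclass w'); last first.
  by rewrite (qclass_entry0 cw') mulr0 mul0r.
have := class_le3 rig x; rewrite leqNgt => /negP; case.
apply/card_geqP; exists [:: y; w; v; w'].
rewrite /= !inE !negb_or yw (eq_sym y) vy (eq_sym w) vw !(eq_sym _ w') w'y w'w w'v; split=> //.
move=> a; rewrite !inE => /or4P[]/eqP->.
- by rewrite cy.
- by rewrite cw.
- by rewrite cv.
- by rewrite -cw' cz.
Qed.

(* Entries of a magic unitary of size at most 3 commute: expanding the unit
   along the row of [p := u x y] gives [p q = p q p], which is self-adjoint. *)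
Lemma class_commute x y z w : qclass y = qclass x -> qclass z = qclass x ->
  qclass w = qclass x -> u x y * u z w = u z w * u x y.
Proof.
move=> cy cz cw.
have [[proj rows _] orth _] := OQu_relations R G.
have [<-|xz] := eqVneq x z.
  have [<-//|yw] := eqVneq y w.
  by rewrite (proj1 (orth _ _ _ yw)) (proj1 (orth _ _ _ _)) // eq_sym.
have [<-|yw] := eqVneq y w.
  by rewrite (proj2 (orth _ _ _ xz)) (proj2 (orth _ _ _ _)) // eq_sym.
have E : u x y * u z w = u x y * u z w * u x y.
  rewrite -[LHS]mulr1 -(rows x) mulr_sumr (bigD1 y) //= big1 ?addr0 // => v vy.
  exact: class_orthogonal_mul.
have [sp _] := proj x y; have [sq _] := proj z w.
have -> : u z w * u x y = star (u x y * u z w) by rewrite starM sp sq.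
by rewrite E !starM sp sq mulrA.
Qed.

(** For moving [x] and [z], transport along links turns [u x y] into an entry of the block of [z],
    where [class_commute] applies. *)
Lemma rigid_commute x y z w : u x y * u z w = u z w * u x y.
Proof.
have [cy|/eqP cy] := eqVneq (qclass x) (qclass y); last first.
  by rewrite (qclass_entry0 cy) mulr0 mul0r.
have [cw|/eqP cw] := eqVneq (qclass z) (qclass w); last first.
  by rewrite (qclass_entry0 cw) mulr0 mul0r.
have [xM|xM] := boolP (x \in moving qclass); last first.
  by rewrite (fixed_entry _ xM) mulr_natl mulr_natr.
have [zM|zM] := boolP (z \in moving qclass); last first.
  by rewrite (fixed_entry _ zM) mulr_natl mulr_natr.
have [x' xx' cx'] := link_classes rig xM zM.
have [y' cy' ->] := link_transport xx' (esym cy).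
by apply: class_commute; rewrite ?cy' ?cx' -?cw.
Qed.

End RigidForest.

Lemma quantum_symmetry_schmidt : is_forest G -> has_quantum_symmetry R G ->
  schmidt_criterion G.
Proof.
move=> fG; apply: contraPP => nS.
apply/CQu_commutative/OQu_commutative/rigid_commute => //.
by apply: not_schmidt_rigid => //; [exact: forest_acyclic|exact: qclass_trans].
Qed.

End QuAut.

Theorem theorem6p23 (R : realType) :
  (forall G : sgraph, is_forest G -> (asymmetric G <-> trivial_Qu R G)) /\
  (forall G H : sgraph, is_forest G -> is_forest H ->
     quantum_isomorphic R G H -> isomorphic G H) /\
  (forall G : sgraph, is_forest G ->
     (has_quantum_symmetry R G <-> schmidt_criterion G)).
Proof.
split; [|split].
- move=> G fG; split; first exact: asymmetric_trivial_Qu.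
  exact: trivial_Qu_asymmetric.
- exact: quantum_isomorphic_forests.
- move=> G fG; split; first exact: quantum_symmetry_schmidt.
  exact: schmidt_quantum_symmetry.
Qed.
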